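(* Let $q^*(n)$ denote the threshold bias of the $3$-AP game on $[n]=\{1,\dots,n\}$. Then, as $n\to\infty$, \[ (1+o(1))\sqrt{\frac{n}{3+\frac{3}{2}\sqrt{3}}}\;\leq\; q^*(n)\;\leq\; \sqrt{2n}+O(1). \] That is, there exist a function $\varepsilon(n)\to 0$ and a constant $C$ such that for all sufficiently large $n$, $(1+\varepsilon(n))\sqrt{n/(3+\frac{3}{2}\sqrt{3})}\le q^*(n)\le \sqrt{2n}+C$.
   Context: A $3$-term arithmetic progression ($3$-AP) is a set of three distinct integers $\{a,a+d,a+2d\}$ with $a\in\mathbb{Z}$ and integer $d>0$. For a positive integer $q$, the $(1,q)$ $3$-AP game on $[n]$ is the following Maker-Breaker game: two players, Maker and Breaker, alternate turns, Maker moving first; in each round Maker claims one previously unclaimed integer of $[n]$, and then Breaker claims $q$ previously unclaimed integers of $[n]$ (or all remaining ones if fewer remain). Maker wins if at some point Maker has claimed all three elements of some $3$-AP contained in $[n]$; Breaker wins if the board is exhausted without this happening (i.e. Breaker claims at least one element of every $3$-AP in $[n]$). The threshold bias $q^*(n)$ is the minimum value of $q$ for which Breaker has a winning strategy in this game. *)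

(* Defs.v *)
From HB Require Import structures.
From mathcomp Require Import all_boot all_order all_algebra.
From mathcomp Require Import all_classical all_reals all_analysis.

Set Implicit Arguments.
Unset Strict Implicit.
Unset Printing Implicit Defensive.

Import Order.TTheory GRing.Theory Num.Theory.
Import numFieldNormedType.Exports.

Local Open Scope ring_scope.

(* The board [n] = {1, ..., n} is indexed by 'I_n; the index i stands for the
   integer i + 1. *)
Definition label (n : nat) (i : 'I_n) : int := i.+1%:Z.

Definition contains_3AP (n : nat) (M : {set 'I_n}) : Prop :=
  exists a d : int, 0 < d /\
    exists x y z : 'I_n, [/\ x \in M, y \in M & z \in M] /\
      [/\ label x = a, label y = a + d & label z = a + 2 * d].

(* A completed round (x, S): Maker claims x, then Breaker claims the set S.
   A history lists the completed rounds, oldest first. *)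
Definition round (n : nat) : Type := ('I_n * {set 'I_n})%type.
Definition history (n : nat) : Type := seq (round n).

Definition maker_set (n : nat) (h : history n) : {set 'I_n} :=
  \bigcup_(r <- h) [set r.1].

Definition breaker_set (n : nat) (h : history n) : {set 'I_n} :=
  \bigcup_(r <- h) r.2.

Definition unclaimed (n : nat) (h : history n) : {set 'I_n} :=
  ~: (maker_set h :|: breaker_set h).

Definition legal_reply (n q : nat) (h : history n) (x : 'I_n)
    (S : {set 'I_n}) : Prop :=
  S \subset unclaimed h :\ x /\ #|S| = minn q #|unclaimed h :\ x|.

(* Breaker's answer may depend on the whole past and on Maker's latest move. *)
Definition breaker_strategy (n : nat) : Type :=
  history n -> 'I_n -> {set 'I_n}.

Inductive play_against (n : nat) (sigma : breaker_strategy n) :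
    history n -> Prop :=
| play_start : play_against sigma [::]
| play_round (h : history n) (x : 'I_n) :
    play_against sigma h -> x \in unclaimed h ->
    play_against sigma (rcons h (x, sigma h x)).

Definition legal_strategy (n q : nat) (sigma : breaker_strategy n) : Prop :=
  forall (h : history n) (x : 'I_n),
    play_against sigma h -> x \in unclaimed h ->
    legal_reply q h x (sigma h x).

(* Maker's set only grows, so Maker has completed a 3-AP at some point of an
   exhausted play iff Maker's final set contains one. *)
Definition winning_strategy (n q : nat) (sigma : breaker_strategy n) : Prop :=
  legal_strategy q sigma /\
  forall h : history n,
    play_against sigma h -> unclaimed h = finset.set0 ->
    ~ contains_3AP (maker_set h).

Definition breaker_wins (n q : nat) : Prop :=
  exists sigma : breaker_strategy n, winning_strategy q sigma.

Lemma breaker_wins_exists (n : nat) :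
  exists q : nat, (0 < q)%N && `[< breaker_wins n q >].
Proof.
exists n.+1; rewrite ltn0Sn; apply/asboolP.
exists (fun h x => unclaimed h :\ x); split.
  move=> h x _ _; split=> //; apply/esym/minn_idPr.
  by apply: leq_trans (max_card _) _; rewrite card_ord.
move=> h ph _.
suff [->|[x [hx _]]] : h = [::] \/
    exists x, maker_set h = [set x]%SET /\ unclaimed h = finset.set0.
- by move=> [a [d [_ [x [y [z [[]]]]]]]]; rewrite /maker_set big_nil inE.
- rewrite hx => -[a [d [d0 [u [v [w [[]]]]]]]].
  rewrite !inE => /eqP-> /eqP-> _ [-> e _].
  by move: d0; rewrite -(ltrDl a) -e ltxx.
elim: ph => [|h' x _ IH xh']; first by left.
right; exists x; case: IH => [->|[y [_ hy]]]; last first.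
  by rewrite hy inE in xh'.
rewrite /unclaimed /maker_set /breaker_set !big_seq1 !big_nil /=.
split=> //; apply/setP => z.
by rewrite !inE; case: (z == x).
Qed.

Definition threshold_bias (n : nat) : nat := ex_minn (breaker_wins_exists n).

(* Main.v *)
(* Lower bound.  Assume that Breaker has a winning strategy with bias q.  Then
   at every moment an unclaimed point u has at most q unclaimed partners z such
   that u, z and a point of Maker form a progression: otherwise Maker would
   take u, and Breaker could not block all the threats.  Call such pairs {u, z}
   edges, and call a progression free if all its points are unclaimed and it
   contains no edge.  Maker always takes a point lying in the largest number a
   of free progressions, which turns them into a new edges.  As Breaker's q
   points kill at most q a free progressions and about q^2 edges,
   (q + 4) #edges + #free progressions decreases by at most q (q + 4)^2 per
   round.  It starts near n^2/4 and ends at 0 after about n/q rounds, so that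
   n <= (4 + o(1)) q^2, and 4 < 3 + (3/2) sqrt 3.

   Upper bound.  Breaker blocks all threats, and has to show that they never
   exceed q.  When Maker owns m points, a new point x creates at most 3 m
   threats, which is too many only for m > q/3, while the game lasts n/q <= q/2
   rounds.  Fix a set Z of density 2/5 which behaves like a random set: for
   every possible set M of Maker, all points w except O(q) of them have at most
   (9/5 + o(1)) |M| third points outside Z.  Breaker spends his spare moves on
   the exceptional points, and then on Z.  Comparing the number of
   claimed points with the number of threats outside Z, Z is exhausted
   by the time m = 3q/10; from then on there are only 9m/5 <= 9q/10 threats.
   Such a set Z is obtained from the trace t(x) = Tr (b theta^(2x)) of a
   primitive element theta of a field with 5^d > 16 n elements, as the set
   where t takes two out of five values: the functions attached to distinct w
   are then exactly orthogonal. *)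
Require Import Defs.
From HB Require Import structures.
From mathcomp Require Import all_boot all_order all_algebra all_solvable all_field.
From mathcomp Require Import zify ring lra.

Set Implicit Arguments.
Unset Strict Implicit.
Unset Printing Implicit Defensive.

(** * Plays and progressions *)

(** Any of the three points may be the middle one, which makes the relation symmetric. It is stated
    on indices instead of labels, as progressions are invariant under translation. *)
Definition ap3 (x y z : nat) : bool :=
  [&& x != y, x != z, y != z
    & [|| x + y == z.*2, x + z == y.*2 | y + z == x.*2]].

Lemma ap3C x y z : ap3 x y z = ap3 y x z.
Proof. by rewrite /ap3; lia. Qed.

Lemma ap3CA x y z : ap3 x y z = ap3 x z y.
Proof. by rewrite /ap3; lia. Qed.

Lemma contains_3APP (n : nat) (M : {set 'I_n}) :
  contains_3AP M <->
  exists x y z : 'I_n, [/\ x \in M, y \in M, z \in M & ap3 x y z].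
Proof.
rewrite /contains_3AP /label; split.
  move=> [a [d [d0 [x [y [z [[xM yM zM] [ex ey ez]]]]]]]].
  by exists x, y, z; split=> //; rewrite /ap3; lia.
move=> [x [y [z [xM yM zM]]]].
wlog: x y z xM yM zM / (x + z = y.*2)%N.
  move=> W; rewrite /ap3 => /and4P[xy xz yz /or3P[] /eqP e].
  - by apply: (W x z y) => //; rewrite /ap3; lia.
  - by apply: (W x y z) => //; rewrite /ap3; lia.
  - by apply: (W y x z) => //; rewrite /ap3; lia.
move=> e; rewrite /ap3 => /and4P[xy xz yz _].
case: (ltnP x y) => lxy.
  exists (x.+1%:Z)%R, ((y - x)%N%:Z)%R; split; first by lia.
  by exists x, y, z; split=> //; split=> //; lia.
exists (z.+1%:Z)%R, ((y - z)%N%:Z)%R; split; first by lia.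
by exists z, y, x; split=> //; split=> //; lia.
Qed.

Section Plays.

Variables (n q : nat).
Implicit Types (h : history n) (x y z u : 'I_n) (S : {set 'I_n}).

Lemma maker_set_rcons h x S : maker_set (rcons h (x, S)) = x |: maker_set h.
Proof. by rewrite /maker_set -cats1 big_cat big_seq1 setUC. Qed.

Lemma breaker_set_rcons h x S :
  breaker_set (rcons h (x, S)) = breaker_set h :|: S.
Proof. by rewrite /breaker_set -cats1 big_cat big_seq1. Qed.

Lemma unclaimed_rcons h x S :
  unclaimed (rcons h (x, S)) = unclaimed h :\ x :\: S.
Proof.
rewrite /unclaimed maker_set_rcons breaker_set_rcons; apply/setP=> z.
by rewrite !inE !negb_or; do !case: (_ \in _) => //=; case: (_ == _).
Qed.

Lemma unclaimed_nil : unclaimed (n := n) [::] = [set: 'I_n].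
Proof.
by rewrite /unclaimed /maker_set /breaker_set !big_nil setU0 setC0.
Qed.

Lemma maker_set_nil : maker_set (n := n) [::] = finset.set0.
Proof. by rewrite /maker_set big_nil. Qed.

Lemma card_unclaimed_reply h x S :
  legal_reply q h x S -> x \in unclaimed h ->
  #|unclaimed (rcons h (x, S))| = #|unclaimed h| - q.+1.
Proof.
move=> [sS cS] xU; rewrite unclaimed_rcons cardsD (setIidPr sS) cS.
rewrite (cardsD1 x (unclaimed h)) xU add1n subSS.
by move: #|_| => k; lia.
Qed.

Lemma card_maker_set (sigma : breaker_strategy n) h :
  play_against sigma h -> #|maker_set h| = size h.
Proof.
elim=> [|h' x _ IH xU]; first by rewrite maker_set_nil cards0.
rewrite maker_set_rcons size_rcons cardsU1 IH.
by move: xU; rewrite !inE negb_or => /andP[-> _].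
Qed.

Lemma card_unclaimed (sigma : breaker_strategy n) h :
  legal_strategy q sigma -> play_against sigma h ->
  #|unclaimed h| = n - size h * q.+1.
Proof.
move=> ls; elim=> [|h' x ph IH xU].
  by rewrite unclaimed_nil cardsT card_ord mul0n subn0.
by rewrite (card_unclaimed_reply (ls _ _ ph xU)) // IH size_rcons; lia.
Qed.

(** The winning condition looks only at exhausted plays; this carries a progression that Maker owns
    earlier to the end of the game. *)
Lemma play_exhaust (sigma : breaker_strategy n) h :
  play_against sigma h ->
  exists h', [/\ play_against sigma h', unclaimed h' = finset.set0
    & maker_set h \subset maker_set h'].
Proof.
move: {2}_.+1 (ltnSn #|unclaimed h|) => k; elim: k h => // k IH h ltk ph.
case: (finset.set_0Vmem (unclaimed h)) => [U0|[x xU]]; first by exists h.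
have ph' := play_round ph xU.
have [|h' [? ? sub]] := IH _ _ ph'.
  rewrite unclaimed_rcons; apply: leq_trans (ltk : #|unclaimed h| <= k).
  rewrite (cardsD1 x (unclaimed h)) xU ltnS.
  by rewrite subset_leq_card // subsetDl.
exists h'; split=> //; apply: subset_trans sub.
by rewrite maker_set_rcons subsetUr.
Qed.

End Plays.

Lemma leq_card_bigcup (I T : finType) (S : {set I}) (F : I -> {set T}) k :
  (forall v, v \in S -> #|F v| <= k) -> #|\bigcup_(v in S) F v| <= #|S| * k.
Proof.
move=> Fk; rewrite -sum_nat_const.
elim/big_rec2: _ => [|v m A vS le]; first by rewrite cards0.
by apply: leq_trans (leq_card_setU _ _) (leq_add (Fk v vS) le).
Qed.

(** * Free progressions and the potential *)

Section Progressions.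

Variable n : nat.
Implicit Types (x y z u w : 'I_n) (T e U S : {set 'I_n}).
Implicit Types E : {set {set 'I_n}}.

Lemma ap3_neq x y z : ap3 x y z -> [/\ x != y, x != z & y != z].
Proof. by case/and4P. Qed.

Lemma card_third w z : #|[set y : 'I_n | ap3 w z y]| <= 3.
Proof.
rewrite cardE -(size_map val).
(* The third point of w and z is one of 2w - z, 2z - w and (w + z) / 2. *)
apply: (@uniq_leq_size _ _ [:: w.*2 - z; z.*2 - w; (w + z)./2]).
  by rewrite map_inj_uniq ?enum_uniq //; apply: val_inj.
move=> k /mapP[y]; rewrite mem_enum inE !in_cons in_nil => h ->.
by move: h; rewrite /ap3 /=; lia.
Qed.

Definition progressions : {set {set 'I_n}} :=
  [set T | [exists x : 'I_n, exists y : 'I_n, exists z : 'I_n,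
    ap3 x y z && (T == [set x; y; z])]].

Lemma progressionsP T :
  reflect (exists x y z : 'I_n, ap3 x y z /\ T = [set x; y; z]) (T \in progressions).
Proof.
rewrite inE; apply: (iffP existsP) => [[x /existsP[y /existsP[z]]]|].
  by move=> /andP[h /eqP->]; exists x, y, z.
move=> [x [y [z [h ->]]]]; exists x; apply/existsP; exists y.
by apply/existsP; exists z; rewrite h eqxx.
Qed.

Lemma progressions_pair T w z : T \in progressions -> w != z ->
  w \in T -> z \in T -> exists2 y : 'I_n, ap3 w z y & T = [set w; z; y].
Proof.
move=> /progressionsP[a [b [c [h ->]]]] wz wT zT.
have [y hy e] : exists2 y : 'I_n, ap3 w z y & [set a; b; c] =i [set w; z; y].
  move: wT zT h wz; rewrite !inE -!orbA => /or3P[] /eqP-> /or3P[] /eqP-> h;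
    rewrite ?eqxx // => _.
  - by exists c.
  - by exists b; [rewrite ap3CA
      |move=> v; rewrite !inE; move: (v == a) (v == b) (v == c) => [] [] []].
  - by exists c; [rewrite ap3C
      |move=> v; rewrite !inE; move: (v == a) (v == b) (v == c) => [] [] []].
  - by exists a; [rewrite ap3CA ap3C
      |move=> v; rewrite !inE; move: (v == a) (v == b) (v == c) => [] [] []].
  - by exists b; [rewrite ap3C ap3CA
      |move=> v; rewrite !inE; move: (v == a) (v == b) (v == c) => [] [] []].
  - by exists a; [rewrite ap3CA ap3C ap3CA
      |move=> v; rewrite !inE; move: (v == a) (v == b) (v == c) => [] [] []].
by exists y => //; apply/setP.
Qed.

Lemma card_progressions_pair w z : w != z ->
  #|[set T in progressions | (w \in T) && (z \in T)]| <= 3.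
Proof.
move=> wz; apply: leq_trans (card_third w z).
apply: leq_trans (leq_imset_card (fun y => [set w; z; y]) _).
apply/subset_leq_card/subsetP=> T; rewrite inE => /and3P[TA wT zT].
have [y hy ->] := progressions_pair TA wz wT zT.
by apply/imsetP; exists y; rewrite ?inE.
Qed.

Definition free_aps E U : {set {set 'I_n}} :=
  [set T in progressions | (T \subset U) && [forall e in E, ~~ (e \subset T)]].

Definition star (F : {set {set 'I_n}}) u := [set T in F | u \in T].

(** A lost member of [F] contains [u] or a point of [S], so a union bound suffices. It serves both
    for edges and for free progressions. *)
Lemma card_not_subset (F : {set {set 'I_n}}) U S u k :
  (forall T, T \in F -> T \subset U) -> 
  (forall v, v \in S -> #|star F v| <= k) ->
  #|F| <= #|[set T in F | T \subset U :\ u :\: S]| + #|star F u| + #|S| * k.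
Proof.
move=> FU Fk; rewrite -addnA.
set G := [set T in F | _].
have sub : F \subset G :|: (star F u :|: \bigcup_(v in S) star F v).
  apply/subsetP=> T TF; rewrite !inE TF /=.
  case: (boolP (u \in T)) => uT; rewrite ?orbT //=.
  case: (boolP (T \subset _)) => //= /subsetPn[v vT].
  rewrite !inE (subsetP (FU _ TF)) // andbT negb_and !negbK.
  case/orP=> [vS|/eqP vu]; last by rewrite -vu vT in uT.
  by apply/bigcupP; exists v => //; rewrite inE TF.
apply: leq_trans (subset_leq_card sub) _.
apply: leq_trans (leq_card_setU _ _) _; rewrite leq_add2l.
apply: leq_trans (leq_card_setU _ _) _; rewrite leq_add2l.
exact: leq_card_bigcup.
Qed.

(* A new edge spoils at most three free progressions, so all new edges together
   cost no more than three further points of Breaker. *)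
Lemma potential_round (q : nat) E U S u :
  u \in U -> S \subset U :\ u -> #|S| <= q ->
  (forall e, e \in E -> e \subset U) ->
  (forall v, v \in U -> #|star E v| <= q) ->
  (forall v, v \in U -> #|star (free_aps E U) v| <= #|star (free_aps E U) u|) ->
  let E1 := E :|: [set T :\ u | T in star (free_aps E U) u] in
  let U' := U :\ u :\: S in
  let E' := [set e in E1 | e \subset U'] in
  is_true ((q + 4) * #|E| + #|free_aps E U| <=
    (q + 4) * #|E'| + #|free_aps E' U'| + (q + 4) ^ 2 * q).
Proof.
move=> uU sS cS EU Eq maxu E1 U' E'.
set Q := free_aps E U; set a := #|star Q u|.
set En := [set T :\ u | T in star Q u].
have QP T : T \in Q -> [/\ T \in progressions, T \subset U &
    forall e, e \in E -> ~~ (e \subset T)].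
  rewrite inE => /and3P[? ? /forallP h]; split=> // e eE.
  by have := h e; rewrite eE.
have SU v : v \in S -> (v \in U) && (v != u).
  by move/(subsetP sS); rewrite !inE andbC.
have cEn : #|En| = a.
  apply: card_in_imset => T T'; rewrite !inE => /andP[_ uT] /andP[_ uT'] e.
  by rewrite -(setD1K uT) e setD1K.
have uEn e : e \in En -> u \notin e.
  by case/imsetP=> T _ ->; rewrite !inE eqxx.
have EnU e : e \in En -> e \subset U.
  case/imsetP=> T; rewrite inE => /andP[/QP[_ TU _] _] ->.
  exact: subset_trans (subsetDl _ _) TU.
(* A free progression contains no edge, so the edge that it yields is new. *)
have dE : [disjoint E & En].
  rewrite disjoint_subset; apply/subsetP=> e eE; rewrite inE.
  apply/imsetP=> -[T]; rewrite inE => /andP[/QP[_ _ nT] _] ee.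
  by have /negP[] := nT e eE; rewrite ee subsetDl.
have cE1 : #|E1| = #|E| + a.
  by rewrite cardsU (disjoint_setI0 dE) cards0 subn0 cEn.
have E1U e : e \in E1 -> e \subset U by rewrite in_setU => /orP[/EU|/EnU].
(* New edges avoid [u], so Maker's move itself destroys only old edges. *)
have sE1u : #|star E1 u| <= q.
  apply: leq_trans (Eq u uU); apply/subset_leq_card/subsetP=> e.
  rewrite !inE => /andP[/orP[->->//|/uEn/negP h1 h2]].
  by case: h1.
have sEn v : v \in S -> #|star En v| <= 3.
  move=> vS; have /andP[vU vu] := SU _ vS.
  apply: leq_trans (card_progressions_pair vu).
  apply: leq_trans (leq_imset_card (fun T => T :\ u) _).
  apply/subset_leq_card/subsetP=> e; rewrite inE => /andP[/imsetP[T Tu ->]].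
  move: Tu; rewrite inE => /andP[/QP[TA _ _] uT]; rewrite !inE => /andP[_ vT].
  apply/imsetP; exists T; rewrite // !inE; apply/and3P; split=> //.
  by move: TA; rewrite inE.
have sE1v v : v \in S -> #|star E1 v| <= q + 3.
  move=> vS; have /andP[vU vu] := SU _ vS.
  have -> : star E1 v = star E v :|: star En v.
    by apply/setP=> e; rewrite !inE andb_orl.
  apply: leq_trans (leq_card_setU _ _) (leq_add (Eq v vU) (sEn _ vS)).
have boundE := card_not_subset u E1U sE1v.
have QU T : T \in Q -> T \subset U by case/QP.
have sQv v : v \in S -> #|star Q v| <= a.
  by move=> vS; apply: maxu; have /andP[] := SU _ vS.
have boundQ := card_not_subset u QU sQv.
set G := [set T in Q | _] in boundQ.
(* A free progression that stays inside [U'] can only be spoiled by a new edge. *)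
have Gsub : G \subset free_aps E' U' :|:
    \bigcup_(e in En) [set T in progressions | e \subset T].
  apply/subsetP=> T; rewrite inE => /andP[TQ TU']; rewrite inE.
  have [TA _ nE] := QP _ TQ.
  case: (boolP [exists e in En, e \subset T]) => [/existsP[e /andP[eEn eT]]|].
    apply/orP; right; apply/bigcupP; exists e => //.
    by rewrite inE eT andbT.
  rewrite negb_exists => /forallP ne; apply/orP; left.
  rewrite inE TA TU' /=; apply/forallP=> e; apply/implyP.
  rewrite 2!inE => /andP[/orP[eE|eEn] _]; first exact: nE.
  by have := ne e; rewrite eEn.
have c3 e : e \in En -> #|[set T in progressions | e \subset T]| <= 3.
  case/imsetP=> T; rewrite inE => /andP[/QP[TA _ _] uT] ->.
  have [x [y [z [h eT]]]] := progressionsP _ TA.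
  have [w [v [wv wu vu wT vT]]] : exists w v, 
      [/\ w != v, w != u, v != u, w \in T & v \in T].
    move: h uT; rewrite eT !inE -!orbA => h /or3P[] /eqP->;
    [exists y, z|exists x, z|exists x, y];
    by rewrite !inE !eqxx ?orbT; have [? ? ?] := ap3_neq h;
      split=> //; rewrite eq_sym.
  apply: leq_trans (card_progressions_pair wv).
  apply/subset_leq_card/subsetP=> T'; rewrite !inE => /andP[-> sT'] /=.
  by rewrite !(subsetP sT') // !inE ?wu ?vu.
have bG : #|G| <= #|free_aps E' U'| + a * 3.
  apply: leq_trans (subset_leq_card Gsub) _.
  apply: leq_trans (leq_card_setU _ _) _; rewrite leq_add2l -cEn.
  exact: leq_card_bigcup.
move: boundE boundQ sE1u bG cS; rewrite cE1 -/U' -/E' -/G -/a -/Q.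
clearbody a; move: #|E'| #|E| #|Q| #|G| #|free_aps _ _| #|S| #|star E1 u|.
clear -a => e' e Q G Q' s st h1 h2 h3 h4 h5.
(* The loss of free progressions is a through Maker's point, q a through Breaker's points and 3 a
   through new edges. The weight q + 4 of an edge lets the a new edges pay exactly for it. *)
have h1' : e + a <= e' + q * (q + 4) by nia.
have h2' : Q <= Q' + (q + 4) * a by nia.
by rewrite expnS expn1; nia.
Qed.

End Progressions.

(** * Maker's win *)

(** The pairs (i, j) encode progressions with middle c and difference d. The middle is at most k for
    j <= i and exceeds k otherwise, so the pair can be recovered; c and d are in turn read off from
    the two extreme points. *)
Lemma card_progressions (n k : nat) : k.*2 < n -> k ^ 2 <= #|progressions n|.
Proof.
case: n => // n; rewrite ltnS => kn.
pose c (i j : nat) := if j <= i then i.+1 else k.*2 - j.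
pose d (i j : nat) := if j <= i then j.+1 else i.+1.
pose f (p : 'I_k * 'I_k) : {set 'I_n.+1} :=
  [set inord (c p.1 p.2 - d p.1 p.2); inord (c p.1 p.2);
       inord (c p.1 p.2 + d p.1 p.2)].
have cd (i j : 'I_k) : [/\ 0 < d i j, d i j <= c i j & c i j + d i j <= n].
  have := ltn_ord i; have := ltn_ord j.
  by rewrite /c /d; case: (leqP j i) => ? ? ?; split; lia.
have bnd (i j : 'I_k) (v : 'I_n.+1) : v \in f (i, j) ->
    c i j - d i j <= v <= c i j + d i j.
  have [d0 dc cn] := cd i j; rewrite !inE -orbA => /or3P[] /eqP -> /=;
  by rewrite inordK; lia.
have ends (i j i' j' : 'I_k) : f (i, j) = f (i', j') ->
    c i' j' - d i' j' <= c i j - d i j /\ c i j + d i j <= c i' j' + d i' j'.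
  have [d0 dc cn] := cd i j => e.
  have := bnd i' j' (inord (c i j - d i j)).
  have := bnd i' j' (inord (c i j + d i j)).
  by rewrite -e !inE !eqxx !orbT !inordK; lia.
have inj : injective f.
  move=> [i j] [i' j'] e; have [e1 e2] := ends _ _ _ _ e.
  have [e3 e4] := ends _ _ _ _ (esym e).
  have [d0 dc cn] := cd i j; have [d0' dc' cn'] := cd i' j'.
  have [ec ed] : c i j = c i' j' /\ d i j = d i' j' by lia.
  have := ltn_ord i; have := ltn_ord j; have := ltn_ord i'; have := ltn_ord j'.
  move: ec ed; rewrite /c /d.
  by case: (leqP j i) => ?; case: (leqP j' i') => ? ? ? ? ? ? ?;
    congr (_, _); apply: val_inj => /=; lia.
rewrite -{1}(card_ord k) expnS expn1 -card_prod.
rewrite -(card_imset _ inj); apply/subset_leq_card/subsetP=> T.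
case/imsetP=> -[i j] _ ->; have [d0 dc cn] := cd i j.
apply/progressionsP; exists (inord (c i j - d i j)), (inord (c i j)),
  (inord (c i j + d i j)); split=> //.
by rewrite /ap3 !inordK; lia.
Qed.

(** * Maker's play against a winning strategy of Breaker *)

Section MakerWins.

Variables (n q : nat) (sigma : breaker_strategy n).
Hypothesis winning : winning_strategy q sigma.

Let legal : legal_strategy q sigma. Proof. by case: winning. Qed.

Lemma play_no_ap h x y z : play_against sigma h ->
  x \in maker_set h -> y \in maker_set h -> z \in maker_set h -> ~~ ap3 x y z.
Proof.
move=> ph xM yM zM; apply/negP=> h3.
have [h' [ph' U0 sub]] := play_exhaust ph.
case: winning => _ /(_ h' ph' U0) [].
by apply/contains_3APP; exists x, y, z; rewrite !(subsetP sub).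
Qed.

Definition threats h (u : 'I_n) : {set 'I_n} :=
  [set z in unclaimed h | [exists y in maker_set h, ap3 u y z]].

Lemma card_threats h u : play_against sigma h -> u \in unclaimed h ->
  #|threats h u| <= q.
Proof.
move=> ph uU; have [sS cS] := legal ph uU.
apply: leq_trans (_ : #|sigma h u| <= q); last by rewrite cS geq_minl.
apply/subset_leq_card/subsetP=> z.
rewrite inE => /andP[zU /existsP[y /andP[yM h3]]]; apply: contraT => zS.
have ph' := play_round ph uU.
have zU' : z \in unclaimed (rcons h (u, sigma h u)).
  rewrite unclaimed_rcons in_setD zS in_setD1 zU andbT /=.
  by have [_ uz _] := ap3_neq h3; rewrite eq_sym.
(* Were z left open by Breaker, Maker would take it next and complete u, y, z. *)
have ph'' := play_round ph' zU'.
suff: ~~ ap3 u y z by rewrite h3.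
apply: (play_no_ap ph'').
- by rewrite !maker_set_rcons !inE eqxx orbT.
- by rewrite !maker_set_rcons !inE yM !orbT.
- by rewrite maker_set_rcons !inE eqxx.
Qed.

(** Only soundness is required: [E] may omit pairs that form a progression with a point of Maker. *)
Definition edges_ok h (E : {set {set 'I_n}}) :=
  forall e, e \in E -> exists w z y : 'I_n,
    [/\ e = [set w; z], w \in unclaimed h, z \in unclaimed h,
        y \in maker_set h & ap3 w z y].

Lemma edges_ok_sub h E e : edges_ok h E -> e \in E -> e \subset unclaimed h.
Proof.
move=> ok /ok[w [z [y [-> wU zU _ _]]]].
by apply/subsetP=> v; rewrite in_set2 => /orP[] /eqP->.
Qed.

Lemma edges_ok_star h E v : play_against sigma h -> edges_ok h E ->
  v \in unclaimed h -> #|star E v| <= q.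
Proof.
move=> ph ok vU; apply: leq_trans (card_threats ph vU).
apply: leq_trans (leq_imset_card (fun z => [set v; z]) _).
apply/subset_leq_card/subsetP=> e; rewrite inE => /andP[/ok[w [z [y]]]].
move=> [-> wU zU yM h3]; rewrite !inE => /orP[] /eqP ->; apply/imsetP.
- exists z => //; rewrite inE zU; apply/existsP; exists y.
  by rewrite yM ap3CA.
- exists w; last by rewrite setUC.
  by rewrite inE wU; apply/existsP; exists y; rewrite yM ap3CA ap3C.
Qed.

Lemma maker_round h E : play_against sigma h -> edges_ok h E ->
  unclaimed h != finset.set0 ->
  exists u E', [/\ u \in unclaimed h,
    edges_ok (rcons h (u, sigma h u)) E' &
    (q + 4) * #|E| + #|free_aps E (unclaimed h)| <=
    (q + 4) * #|E'| + #|free_aps E' (unclaimed (rcons h (u, sigma h u)))| +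
    (q + 4) ^ 2 * q].
Proof.
move=> ph ok /set0Pn[u0 u0U].
pose u :=
  [arg max_(v > u0 in unclaimed h) #|star (free_aps E (unclaimed h)) v|].
have [uU maxu] : u \in unclaimed h /\ forall v, v \in unclaimed h ->
    #|star (free_aps E (unclaimed h)) v| <=
    #|star (free_aps E (unclaimed h)) u|.
  by rewrite /u; case: arg_maxnP.
have [sS cS] := legal ph uU.
have cS' : #|sigma h u| <= q by rewrite cS geq_minl.
have := potential_round uU sS cS' (fun e => @edges_ok_sub h E e ok)
  (fun v => edges_ok_star ph ok) maxu.
rewrite /= -unclaimed_rcons; set E' := [set e in _ | _] => le.
exists u, E'; split=> // e; rewrite inE => /andP[eE1 sub].
have {}sub v : v \in e -> v \in unclaimed (rcons h (u, sigma h u)).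
  exact: (subsetP sub).
move: eE1; rewrite inE => /orP[/ok[w [z [y [ee _ _ yM h3]]]]|].
  exists w, z, y; split=> //; rewrite ?sub ?ee ?inE ?eqxx ?orbT //.
  by rewrite maker_set_rcons !inE yM orbT.
case/imsetP=> T; rewrite inE => /andP[]; rewrite inE => /andP[TA _] uT eT.
have [x [y [z [h3 exyz]]]] := progressionsP _ TA.
have [w wu wT] : exists2 w, w != u & w \in T.
  case: (eqVneq x u) => [xu|xu]; last by exists x; rewrite // exyz !inE eqxx.
  exists y; last by rewrite exyz !inE eqxx orbT.
  by have [xy _ _] := ap3_neq h3; rewrite -xu eq_sym.
have [v h3' Tv] := progressions_pair TA wu wT uT.
have ewv : e = [set w; v].
  apply/setP=> r; rewrite eT Tv !inE.
  have [_ wv uv] := ap3_neq h3'; case: (eqVneq r u) => [->|] /=.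
    by rewrite eq_sym (negbTE wu) (negbTE uv).
  by rewrite orbF.
(* A new edge is a free progression without u, and u now belongs to Maker. *)
exists w, v, u; split=> //; rewrite ?sub ?ewv ?inE ?eqxx ?orbT //.
  by rewrite maker_set_rcons !inE eqxx.
by rewrite ap3CA.
Qed.

(** Each round costs the potential at most (q + 4)^2 q, and on an exhausted board no edge and no
    free progression is left. A round starts only if [size h * q.+1 < n], hence the bound n + q
    after it. *)
Lemma maker_exhaust h E : play_against sigma h -> edges_ok h E ->
  size h * q.+1 <= n + q ->
  #|progressions n| <= (q + 4) * #|E| + #|free_aps E (unclaimed h)| +
    size h * ((q + 4) ^ 2 * q) ->
  exists2 m, m * q.+1 <= n + q & #|progressions n| <= m * ((q + 4) ^ 2 * q).
Proof.
move: {2}_.+1 (ltnSn #|unclaimed h|) => k; elim: k h E => // k IH h E ltk.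
move=> ph ok szh le; case: (eqVneq (unclaimed h) finset.set0) => [U0|Un0].
  exists (size h) => //; apply: leq_trans le _.
  have -> : E = finset.set0.
    apply/setP=> e; rewrite inE; apply/negP=> /ok[w [z [y [_]]]].
    by rewrite U0 inE.
  have -> : free_aps finset.set0 (unclaimed h) = finset.set0.
    apply/setP=> T; rewrite in_set0; apply/negP; rewrite inE U0 subset0.
    move=> /and3P[/progressionsP[x [y [z [_ ->]]]] /eqP/setP/(_ x)].
    by rewrite !inE eqxx.
  by rewrite !cards0 muln0.
have [u [E' [uU ok' le']]] := maker_round ph ok Un0.
apply: (IH (rcons h (u, sigma h u)) E') => //.
- rewrite (card_unclaimed_reply (legal ph uU)) //.
  by move: Un0 ltk; rewrite -card_gt0; lia.
- exact: play_round.
- rewrite size_rcons; move: Un0; rewrite -card_gt0 (card_unclaimed legal ph).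
  by rewrite subn_gt0; lia.
- apply: leq_trans le _; rewrite size_rcons mulSn; move: le'.
  by move: (_ ^ 2 * q) => b; lia.
Qed.

Lemma breaker_wins_progressions_bound :
  #|progressions n| * q.+1 <= (n + q) * ((q + 4) ^ 2 * q).
Proof.
have [||||m] := @maker_exhaust [::] finset.set0.
- exact: play_start.
- by move=> e; rewrite inE.
- by [].
- rewrite cards0 muln0 mul0n addn0 add0n unclaimed_nil subset_leq_card //.
  apply/subsetP=> T TA; rewrite inE TA subsetT; apply/forallP=> e.
  by rewrite inE.
move=> hm le; apply: leq_trans (leq_mul le (leqnn _)) _.
by rewrite mulnAC; apply: leq_mul.
Qed.

End MakerWins.

(** After multiplication by 1000, the left side is about 250 n^2 and the right side about 231 n^2; n
    >= 10^4 absorbs the linear terms. *)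
Lemma maker_numeric (n k q : nat) :
  100 * 100 <= n -> 5 * (q * q) <= n -> n - 2 <= k.*2 ->
  k * k <= (n + q) * ((q + 4) * (q + 4)) -> False.
Proof.
move=> n0 qn kn le2.
(* The two sides differ by (q - 40)^2. *)
have h1 : 10 * ((q + 4) * (q + 4)) <= 11 * (q * q) + 1760 by nia.
have h2 : 50 * ((q + 4) * (q + 4)) <= 11 * n + 88 * 100 by lia.
have h3 : 20 * q <= n by nia.
have h4 : 1000 * (k * k) <= (21 * n) * (11 * n + 88 * 100).
  have h : 20 * (n + q) <= 21 * n by lia.
  by have := leq_mul h h2; move: le2; move: ((q + 4) * _) => r; nia.
have := leq_mul kn kn; rewrite -!muln2 => h5.
have [p pn] : exists p, n = p + 100 * 100 by exists (n - 100 * 100); lia.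
by move: h4 h5; rewrite pn; clear; nia.
Qed.

Lemma breaker_loses (n q : nat) :
  100 * 100 <= n -> 5 * q ^ 2 <= n -> ~ breaker_wins n q.
Proof.
move=> n0 qn [sigma win]; have := breaker_wins_progressions_bound win.
pose k := n.-1./2.
have kn : k.*2 < n by rewrite /k; lia.
move=> le.
have {}le := leq_trans (leq_mul (card_progressions kn) (leqnn q.+1)) le.
have {}kn : n - 2 <= k.*2 by rewrite /k; lia.
move: qn le; rewrite -!mulnn => qn le.
apply: (maker_numeric n0 qn kn).
rewrite -(leq_pmul2r (ltn0Sn q)); apply: leq_trans le _.
by rewrite -!mulnA !leq_mul //; lia.
Qed.

(** * A pseudorandom set of density 2/5 *)

Section PseudorandomSet.

Import Order.TTheory GRing.Theory Num.Theory.
Local Open Scope ring_scope.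

(** * The trace to the field of five elements *)

Section Trace.

Variables (F : finFieldType) (d : nat).
Hypotheses (charF : 5%N \in [pchar F]) (d_gt0 : (0 < d)%N)
  (cardF : #|F| = (5 ^ d)%N).

(** The absolute trace, with values kept in [F]; elements of the prime field are recognised by v^5 =
    v. *)
Definition tr (x : F) : F := \sum_(i < d) x ^+ (5 ^ i).

Lemma trD x y : tr (x + y) = tr x + tr y.
Proof.
rewrite /tr -big_split; apply: eq_bigr => i _ /=.
by apply: exprDn_pchar; rewrite pnatX pnatE // charF.
Qed.

Lemma fixed5X (v : F) i : v ^+ 5 = v -> v ^+ (5 ^ i) = v.
Proof. by move=> v5; elim: i => // i IH; rewrite expnS exprM v5. Qed.

Lemma tr_scale (v x : F) : v ^+ 5 = v -> tr (v * x) = v * tr x.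
Proof.
move=> v5; rewrite /tr mulr_sumr; apply: eq_bigr => i _.
by rewrite exprMn (fixed5X _ v5).
Qed.

Lemma trN x : tr (- x) = - tr x.
Proof.
apply/eqP; rewrite -addr_eq0 -trD addNr /tr big1 // => i _.
by rewrite expr0n expn_eq0.
Qed.

Lemma trMn x k : tr (x *+ k) = tr x *+ k.
Proof.
elim: k => [|k IH]; last by rewrite !mulrS trD IH.
by rewrite !mulr0n /tr big1 // => i _; rewrite expr0n expn_eq0.
Qed.

Lemma tr_fixed5 x : tr x ^+ 5 = tr x.
Proof.
rewrite -(pFrobenius_autE charF) rmorph_sum /=.
under eq_bigr => i _ do rewrite pFrobenius_autE -exprM -expnSr.
(* Frobenius permutes the summands cyclically, because x^(5^d) = x. *)
rewrite /tr -(prednK d_gt0) big_ord_recr big_ord_recl /=.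
rewrite (prednK d_gt0) -cardF expf_card expn0 expr1 addrC; congr (_ + _).
Qed.

(** The trace is a nonzero polynomial of degree at most 5^(d-1), too small to vanish at all 5^d
    elements. *)
Lemma tr_neq0 : exists x, tr x != 0.
Proof.
apply/existsP; apply: contraT; rewrite negb_exists => /forallP tr0.
pose P : {poly F} := \sum_(i < d) 'X^(5 ^ i).
have P0 : P != 0.
  apply/eqP=> /(congr1 (fun p : {poly F} => p`_1)); rewrite coef0 coef_sum.
  rewrite -(prednK d_gt0) big_ord_recl big1 /=.
    by rewrite coefXn addr0 => /eqP; rewrite oner_eq0.
  move=> i _; rewrite coefXn expnS; case: eqP => //.
  have := expn_gt0 5 i; lia.
have rt : all (root P) (enum F).
  apply/allP=> x _; rewrite rootE /P horner_sum.
  under eq_bigr => i _ do rewrite hornerXn.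
  by have := tr0 x; rewrite negbK.
have := max_poly_roots P0 rt (enum_uniq _).
have szP : (size P <= (5 ^ d.-1).+1)%N.
  apply: leq_trans (size_sum _ _ _) _; apply/bigmax_leqP=> i _.
  by rewrite size_polyXn ltnS leq_pexp2l //; have := ltn_ord i; lia.
rewrite -cardE cardF => lt; have := leq_trans lt szP.
rewrite ltnS -{1}(prednK d_gt0) expnS; have := expn_gt0 5 d.-1; lia.
Qed.

Lemma tr_mul_neq0 (k : F) : k != 0 -> exists x, tr (k * x) != 0.
Proof.
by move=> k0; have [x tx] := tr_neq0; exists (x / k); rewrite mulrC divfK.
Qed.

(** If the kernel of x -> tr (k' x) lay in that of x -> tr (k x), the two functionals would be
    proportional: k = c k' with c in the prime field, so c^4 = 1 and the fourth powers would
    agree. *)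
Lemma tr_separate (k k' : F) : k != 0 -> k' != 0 -> k ^+ 4 != k' ^+ 4 ->
  exists2 x, tr (k * x) != 0 & tr (k' * x) = 0.
Proof.
move=> k0 k0' kk'.
suff /existsP[x /andP[x1 x2]] :
    [exists x, (tr (k' * x) == 0) && (tr (k * x) != 0)].
  by exists x => //; apply/eqP.
apply: contraT; rewrite negb_exists => /forallP h.
have {}h x : tr (k' * x) = 0 -> tr (k * x) = 0.
  by move=> e; have := h x; rewrite e eqxx /= negbK => /eqP.
have [e te] := tr_mul_neq0 k0'.
pose c := tr (k * e) / tr (k' * e).
have div5 x y : (tr x / tr y) ^+ 5 = tr x / tr y.
  by rewrite expr_div_n !tr_fixed5.
have c5 : c ^+ 5 = c by exact: div5.
have kc : k = c * k'.
  apply/eqP; rewrite -subr_eq0; apply: contraT => /tr_mul_neq0[x].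
  rewrite mulrBl trD trN -mulrA (tr_scale _ c5) => /eqP[].
  pose v := tr (k' * x) / tr (k' * e).
  have v5 : v ^+ 5 = v by exact: div5.
  have := h (x - v * e); rewrite !mulrBr !trD !trN !(mulrCA _ v).
  rewrite !(tr_scale _ v5) divfK // subrr => /(_ erefl)/eqP.
  rewrite subr_eq0 => /eqP ->.
  by rewrite /c /v mulrAC [X in _ - X]mulrAC (mulrC (tr (k * e))) subrr.
have c0 : c != 0 by apply: contraNneq k0 => c0; rewrite kc c0 mul0r.
have c4 : c ^+ 4 = 1 by apply: (mulfI c0); rewrite -exprS c5 mulr1.
by rewrite kc exprMn c4 mul1r eqxx in kk'.
Qed.

Lemma eq_natr5 a b : (a < 5)%N -> (b < 5)%N -> (a%:R == b%:R :> F) = (a == b).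
Proof.
wlog ab : a b / (a <= b)%N.
  move=> W a5 b5; case: (leqP a b) => [|/ltnW] h; first exact: W.
  by rewrite eq_sym W // eq_sym.
move=> a5 b5; rewrite eq_sym -subr_eq0 -natrB // -(dvdn_pcharf charF).
apply/idP/eqP => [|->]; last by rewrite subnn.
by rewrite /dvdn modn_small ?subn_eq0; lia.
Qed.

Lemma fixed5P (v : F) : v ^+ 5 = v -> exists i : 'I_5, v = i%:R.
Proof.
move=> v5.
suff /existsP[i /eqP ->] : [exists i : 'I_5, v == i%:R] by exists i.
apply: contraT; rewrite negb_exists => /forallP nv.
pose P : {poly F} := 'X^5 - 'X.
have szP : size P = 6%N.
  by rewrite /P size_polyDl size_polyXn // size_polyN size_polyX.
have P0 : P != 0 by rewrite -size_poly_eq0 szP.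
pose rs := v :: [seq i%:R | i <- iota 0 5].
have rP : all (root P) rs.
  have rootP x : root P x = (x ^+ 5 == x).
    by rewrite rootE /P !hornerE subr_eq0.
  rewrite /= !rootP v5 !eqxx /=.
  have h i : i%:R ^+ 5 = i%:R :> F.
    by rewrite -(pFrobenius_autE charF) rmorph_nat.
  by rewrite !(h 0%N, h 1%N, h 2%N, h 3%N, h 4%N) !eqxx.
have uq : uniq rs.
  rewrite cons_uniq map_inj_in_uniq ?iota_uniq ?andbT.
    apply/mapP=> -[i]; rewrite mem_iota => i5 e.
    by have := nv (Ordinal (i5 : i < 5)%N); rewrite /= e eqxx.
  by move=> a b; rewrite !mem_iota => a5 b5 /eqP; rewrite eq_natr5 // => /eqP.
by have := max_poly_roots P0 rP uq; rewrite szP.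
Qed.

(* On the prime field, this is five times the centred indicator function of
   the complement of {3, 4}. *)
Definition gval (v : F) : int := if (v == 3) || (v == 4) then -3 else 2.

Lemma gval_natr m :
  gval m%:R = if (m %% 5 == 3)%N || (m %% 5 == 4)%N then -3 else 2.
Proof.
rewrite /gval -(GRing.natr_mod_pchar charF m).
by rewrite !(eq_natr5 (ltn_pmod m (isT : 0 < 5)%N)).
Qed.

(** The points v + k t run through the prime field, where [gval] takes the values 2, 2, 2, -3,
    -3. *)
Lemma gval_sum (v t : F) : v ^+ 5 = v -> t ^+ 5 = t -> t != 0 ->
  \sum_(k < 5) gval (v + t *+ k) = 0.
Proof.
move=> /fixed5P[i ->] /fixed5P[j ->] j0.
have {}j0 : (j != 0 :> nat)%N by apply: contraNneq j0 => ->.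
under eq_bigr => k _ do rewrite -mulrnA -natrD gval_natr.
rewrite !big_ord_recr big_ord0 /=.
by case: i => -[|[|[|[|[|]]]]] // ?; case: j j0 => -[|[|[|[|[|]]]]].
Qed.

(** Averaging over the translations by 0, x, ..., 4x leaves [H] unchanged and turns the other factor
    into a full sum over the prime field. *)
Lemma gval_avg (k x : F) (H : F -> int) : tr (k * x) != 0 ->
  (forall b, H (b + x) = H b) -> \sum_b gval (tr (k * b)) * H b = 0.
Proof.
move=> tx Hx; set S := \sum_b _.
have Hxn b m : H (b + x *+ m) = H b.
  by elim: m => [|m IH]; rewrite ?addr0 // mulrSr addrA Hx.
have e m : S = \sum_b gval (tr (k * b) + tr (k * x) *+ m) * H b.
  rewrite /S (reindex_inj (addIr (x *+ m))); apply: eq_bigr => b _ /=.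
  by rewrite Hxn mulrDr trD mulrnAr trMn.
suff : S *+ 5 = 0 by move/eqP; rewrite mulrn_eq0 => /eqP.
rewrite -[5%N]card_ord -sumr_const.
under eq_bigr => m _ do rewrite (e m).
rewrite exchange_big big1 // => b _ /=; rewrite -mulr_suml.
by rewrite gval_sum ?mul0r // tr_fixed5.
Qed.

Lemma gval_mean (k : F) : k != 0 -> \sum_b gval (tr (k * b)) = 0.
Proof.
move=> /tr_mul_neq0[x tx].
have := @gval_avg k x (fun=> 1) tx (fun=> erefl).
by under eq_bigr do rewrite mulr1.
Qed.

Lemma gval_orth (k k' : F) : k != 0 -> k' != 0 -> k ^+ 4 != k' ^+ 4 ->
  \sum_b gval (tr (k * b)) * gval (tr (k' * b)) = 0.
Proof.
move=> k0 k0' kk'; have [x tx t0] := tr_separate k0 k0' kk'.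
by apply: (gval_avg tx) => b; rewrite mulrDr trD t0 addr0.
Qed.

Lemma gval_norm (k : F) : \sum_b gval (tr (k * b)) ^+ 2 <= 9 * (5 ^ d)%N%:R.
Proof.
rewrite -cardF mulr_natr -sumr_const ler_sum // => b _.
by rewrite /gval; case: ifP.
Qed.

End Trace.

(** * Bilinear sums *)

Lemma sqr_sum_le (I : finType) (M : {set I}) (v : I -> int) :
  (\sum_(y in M) v y) ^+ 2 <= #|M|%:R * \sum_(y in M) v y ^+ 2.
Proof.
(* Cauchy-Schwarz against the constant 1, by expanding the squares of all differences. *)
have h : 0 <= \sum_(x in M) \sum_(y in M) (v x - v y) ^+ 2.
  by apply: sumr_ge0 => x _; apply: sumr_ge0 => y _; apply: sqr_ge0.
have e : \sum_(x in M) \sum_(y in M) (v x - v y) ^+ 2 =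
    2 * (#|M|%:R * \sum_(y in M) v y ^+ 2 - (\sum_(y in M) v y) ^+ 2).
  have e1 : \sum_(x in M) \sum_(y in M) v x ^+ 2 =
      #|M|%:R * \sum_(y in M) v y ^+ 2.
    under eq_bigr => x _ do rewrite sumr_const -mulr_natl.
    by rewrite -mulr_sumr.
  have e2 : \sum_(x in M) \sum_(y in M) v y ^+ 2 =
      #|M|%:R * \sum_(y in M) v y ^+ 2.
    by rewrite exchange_big e1.
  have e3 : \sum_(x in M) \sum_(y in M) v x * v y = (\sum_(y in M) v y) ^+ 2.
    rewrite expr2 mulr_suml; apply: eq_bigr => x _.
    by rewrite mulr_sumr.
  transitivity (\sum_(x in M) \sum_(y in M) v x ^+ 2 +
    \sum_(x in M) \sum_(y in M) v y ^+ 2 -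
    (\sum_(x in M) \sum_(y in M) v x * v y) *+ 2).
    rewrite -sumrMnl -big_split -sumrB; apply: eq_bigr => x _.
    rewrite -sumrMnl -big_split -sumrB; apply: eq_bigr => y _ /=.
    by ring.
  by rewrite e1 e2 e3; ring.
by move: h; rewrite e; lia.
Qed.

Section Bilinear.

Variables (F : finFieldType) (d : nat).
Hypotheses (charF : 5%N \in [pchar F]) (d_gt0 : (0 < d)%N)
  (cardF : #|F| = (5 ^ d)%N).
Variable I : finType.
Implicit Types W M : {set I}.

(** Cauchy-Schwarz in y, after which injectivity of [l] allows extending the sum of squares to the
    whole field. There [gval_orth] removes the off-diagonal terms; its hypothesis is the reason for
    the fourth powers. *)
Lemma bilinear_bound (k l : I -> F) W M : injective l ->
  (forall w, k w != 0) -> injective (fun w => k w ^+ 4) ->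
  (\sum_(w in W) \sum_(y in M) gval (tr d (k w * l y))) ^+ 2 <=
    9 * #|M|%:R * #|W|%:R * (5 ^ d)%N%:R.
Proof.
move=> l_inj k0 k_inj; rewrite exchange_big /=.
pose V b := \sum_(w in W) gval (tr d (k w * b)).
apply: le_trans (sqr_sum_le _ _) _; rewrite -/V.
have V1 : \sum_(y in M) V (l y) ^+ 2 <= \sum_b V b ^+ 2.
  rewrite -(big_imset (fun b => V b ^+ 2)) /=; last by move=> x y _ _ /l_inj.
  rewrite [leRHS](bigID (mem (l @: M))) /= lerDl.
  by apply: sumr_ge0 => b _; apply: sqr_ge0.
have V2 : \sum_b V b ^+ 2 = 
    \sum_(w in W) \sum_b gval (tr d (k w * b)) ^+ 2.
  transitivity (\sum_(w in W) \sum_(w' in W) \sum_b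
      gval (tr d (k w * b)) * gval (tr d (k w' * b))).
    under [RHS]eq_bigr => w _ do rewrite exchange_big /=.
    rewrite exchange_big; apply: eq_bigr => b _ /=.
    by rewrite expr2 mulr_suml; apply: eq_bigr => w _; rewrite mulr_sumr.
  apply: eq_bigr => w wW; rewrite (bigD1 w) //= [X in _ + X]big1 ?addr0.
    by apply: eq_bigr => b _; rewrite expr2.
  move=> w' /andP[_ ww']; apply: (gval_orth charF d_gt0 cardF) => //.
  by rewrite (inj_eq k_inj) eq_sym.
have V3 : \sum_b V b ^+ 2 <= #|W|%:R * (9 * (5 ^ d)%N%:R).
  rewrite V2 mulr_natl -sumr_const ler_sum // => w _.
  exact: gval_norm.
have := ler_wpM2l (ler0n _ #|M|) (le_trans V1 V3).
move=> h; apply: le_trans h _; rewrite le_eqVlt; apply/orP; left.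
by apply/eqP; ring.
Qed.

End Bilinear.

Lemma finField_prim_root (F : finFieldType) :
  exists t : F, (#|F|.-1).-primitive_root t.
Proof.
pose rs := [seq x <- enum F | x != 0].
have gt1 : (1 < #|F|)%N := finNzRing_gt1 F.
have N0 : (0 < #|F|.-1)%N by rewrite -ltnS prednK // ltnW.
have sz : size rs = #|F|.-1.
  rewrite -(cardC1 (0 : F)) cardE /rs; congr size.
  by rewrite /enum_mem -filter_predI; apply: eq_filter => x /=; rewrite andbT.
have := @has_prim_root F #|F|.-1 rs N0.
case/(_ _ _ _)/hasP; last by move=> t _ ht; exists t.
- apply/allP=> x; rewrite mem_filter => /andP[x0 _]; apply/unity_rootP.
  apply: (mulfI x0); rewrite -exprS prednK ?expf_card ?mulr1 //.
  exact: ltnW.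
- by rewrite filter_uniq ?enum_uniq.
- by rewrite sz.
Qed.

Definition thirds_off (n : nat) (Z M : {set 'I_n}) (w : 'I_n) : {set 'I_n} :=
  [set z | (z \notin Z) && [exists y in M, ap3 w y z]].

(** * The set where the trace takes two out of five values *)

Section SparseSet.

Variables (F : finFieldType) (d n : nat) (t b : F).
Hypotheses (charF : 5%N \in [pchar F]) (d_gt0 : (0 < d)%N)
  (cardF : #|F| = (5 ^ d)%N) (t_prim : (5 ^ d).-1.-primitive_root t)
  (b_neq0 : b != 0) (nd : (16 * n + 1 < 5 ^ d)%N).
Implicit Types (w y z : 'I_n) (M W : {set 'I_n}).

Definition alive (x : F) : bool := ~~ ((tr d x == 3) || (tr d x == 4)).
Definition dead_set : {set 'I_n} := [set z : 'I_n | ~~ alive (b * t ^+ z.*2)].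

Lemma gval_alive x : gval (tr d x) = 5 * (alive x)%:R - 3.
Proof. by rewrite /gval /alive; case: ifP. Qed.

Lemma t_neq0 : t != 0.
Proof.
apply/eqP=> t0; have := prim_expr_order t_prim; rewrite t0 expr0n.
have : (0 < (5 ^ d).-1)%N by move: nd; clear; lia.
by case: (5 ^ d).-1 => //= ? _ /eqP; rewrite eq_sym oner_eq0.
Qed.

(** The exponents stay below the order 5^d - 1 of t. The factor 16 arises from fourth powers of
    t^(4w). *)
Lemma texp_inj c : (0 < c <= 16)%N -> injective (fun w : 'I_n => t ^+ (c * w)).
Proof.
move=> /andP[c0 c16] w w' /eqP; rewrite (eq_prim_root_expr t_prim).
have lt (v : 'I_n) : (c * v < (5 ^ d).-1)%N.
  by have := ltn_ord v; have := leq_mul c16 (leqnn v); lia.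
by rewrite !modn_small // eqn_pmul2l // => /eqP/val_inj.
Qed.

Lemma alive_shift (x : F) (P : pred 'I_n) :
  (forall z, P z -> b * t ^+ z.*2 = x) ->
  {in P &, forall z z', z = z'} ->
  (#|[set z | (z \notin dead_set) && P z]| <= alive x)%N.
Proof.
move=> Px Pu; set A := [set z | _].
case: (set_0Vmem A) => [->|[z]]; first by rewrite cards0.
rewrite !inE negbK => /andP[az Pz]; rewrite -(Px z Pz) az /=.
rewrite -(cards1 z); apply/subset_leq_card/subsetP=> z'.
by rewrite !inE => /andP[_ Pz']; apply/eqP/Pu.
Qed.

(* The third point of w and y is 2w - y, 2y - w or (w + y) / 2; the exponent 2z
   in [dead_set] makes each of them a product of powers indexed by w and y. *)
Lemma card_thirds_off M w : (#|thirds_off dead_set M w| <= \sum_(y in M)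
  (alive (b * t ^+ (4 * w) * (t ^+ (2 * y))^-1)%R +
   alive (b * (t ^+ (2 * w))^-1 * t ^+ (4 * y))%R +
   alive (b * t ^+ (1 * w) * t ^+ (1 * y))%R))%N.
Proof.
pose D y := [set z : 'I_n | (z \notin dead_set) && ap3 w y z].
have sub : thirds_off dead_set M w \subset \bigcup_(y in M) D y.
  apply/subsetP=> z; rewrite inE => /andP[zd /exists_inP[y yM h]].
  by apply/bigcupP; exists y => //; rewrite inE zd.
apply: leq_trans (subset_leq_card sub) _.
apply: (@leq_trans (\sum_(y in M) #|D y|)).
  elim/big_rec2: _ => [|y m A yM le]; first by rewrite cards0.
  by apply: leq_trans (leq_card_setU _ _) _; rewrite leq_add2l.
apply: leq_sum => y yM.
pose PA (z : 'I_n) := (z + y == w.*2)%N.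
pose PB (z : 'I_n) := (z + w == y.*2)%N.
pose PC (z : 'I_n) := (w + y == z.*2)%N.
have subD : D y \subset [set z | (z \notin dead_set) && PA z] :|:
    [set z | (z \notin dead_set) && PB z] :|:
    [set z | (z \notin dead_set) && PC z].
  apply/subsetP=> z; rewrite !in_set => /andP[-> /and4P[_ _ _]] /=.
  by rewrite /PA /PB /PC; lia.
apply: leq_trans (subset_leq_card subD) _.
apply: leq_trans (leq_card_setU _ _) (leq_add _ _).
  apply: leq_trans (leq_card_setU _ _) (leq_add _ _).
    apply: alive_shift => [z /eqP e|z z' /eqP e /eqP e'];
      last by apply: val_inj => /=; lia.
    have -> : (4 * w = z.*2 + 2 * y)%N by lia.
    by rewrite exprD mulrA mulfK // expf_neq0 // t_neq0.
  apply: alive_shift => [z /eqP e|z z' /eqP e /eqP e'];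
      last by apply: val_inj => /=; lia.
  have -> : (4 * y = z.*2 + 2 * w)%N by lia.
  by rewrite exprD mulrA mulrAC divfK ?expf_neq0 ?t_neq0.
apply: alive_shift => [z /eqP e|z z' /eqP e /eqP e'];
      last by apply: val_inj => /=; lia.
by rewrite -mulrA -exprD; congr (_ * _ ^+ _); lia.
Qed.

(** As [gval] is 5 [alive] - 3, the excess of 5 [#|thirds_off|] over 9 |M| is at most a sum of three
    [gval] sums, one for each shape of the third point. Summed over [W], they become bilinear
    sums. *)
Lemma sparse_bound M W (s : nat) :
  (forall w, w \in W -> 9 * #|M| + s <= 5 * #|thirds_off dead_set M w|)%N ->
  (s ^ 2 * #|W| <= 81 * #|M| * 5 ^ d)%N.
Proof.
move=> hW.
pose X (k l : 'I_n -> F) := \sum_(w in W) \sum_(y in M) gval (tr d (k w * l y)).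
pose kA (w : 'I_n) := b * t ^+ (4 * w); pose lA (y : 'I_n) := (t ^+ (2 * y))^-1.
pose kB (w : 'I_n) := b * (t ^+ (2 * w))^-1; pose lB (y : 'I_n) := t ^+ (4 * y).
pose kC (w : 'I_n) := b * t ^+ (1 * w); pose lC (y : 'I_n) := t ^+ (1 * y).
have b4 : b ^+ 4 != 0 by rewrite expf_neq0.
have tn0 m : t ^+ m != 0 by rewrite expf_neq0 // t_neq0.
have XA : X kA lA ^+ 2 <= 9 * #|M|%:R * #|W|%:R * (5 ^ d)%N%:R.
  apply: bilinear_bound => //.
  - by move=> y y' /invr_inj; apply: texp_inj.
  - by move=> w; rewrite mulf_neq0.
  - move=> w w'; rewrite /kA !exprMn => /(mulfI b4); 
    rewrite -!exprM !(mulnC _ 4) !mulnA; exact: texp_inj.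
have XB : X kB lB ^+ 2 <= 9 * #|M|%:R * #|W|%:R * (5 ^ d)%N%:R.
  apply: bilinear_bound => //.
  - exact: texp_inj.
  - by move=> w; rewrite mulf_neq0 ?invr_neq0.
  - move=> w w'; rewrite /kB !exprMn !exprVn => /(mulfI b4)/invr_inj.
    rewrite -!exprM !(mulnC _ 4) !mulnA; exact: texp_inj.
have XC : X kC lC ^+ 2 <= 9 * #|M|%:R * #|W|%:R * (5 ^ d)%N%:R.
  apply: bilinear_bound => //.
  - exact: texp_inj.
  - by move=> w; rewrite mulf_neq0.
  - move=> w w'; rewrite /kC !exprMn => /(mulfI b4); 
    rewrite -!exprM !(mulnC _ 4) !mulnA; exact: texp_inj.
have low : (#|W| * s)%N%:R <= X kA lA + X kB lB + X kC lC.
  rewrite -sum_nat_const natr_sum /X -!big_split /=; apply: ler_sum => w wW.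
  have h1 := hW w wW; have h2 := card_thirds_off M w.
  have : (9 * #|M| + s)%N%:R <= 5 * (\sum_(y in M)
  (alive (b * t ^+ (4 * w) * (t ^+ (2 * y))^-1)%R +
   alive (b * (t ^+ (2 * w))^-1 * t ^+ (4 * y))%R +
   alive (b * t ^+ (1 * w) * t ^+ (1 * y))%R))%N%:R :> int.
    by rewrite -natrM ler_nat; apply: leq_trans h1 _; rewrite leq_mul2l h2 orbT.
  rewrite natr_sum -!big_split /= natrD natrM -lerBrDl => h.
  apply: le_trans h _; rewrite mulr_natr -sumr_const mulr_sumr -sumrB.
  rewrite le_eqVlt; apply/orP; left; apply/eqP; apply: eq_bigr => y _.
  by rewrite !gval_alive /kA /lA /kB /lB /kC /lC !natrD; ring.
move: XA XB XC low; set P := 9 * _ * _ * _.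
move: (X kA lA) (X kB lB) (X kC lC) => x y z xP yP zP low.
have h : ((#|W| * s) ^ 2)%N%:R <= 9 * P.
  rewrite natrX; apply: (@le_trans _ _ ((x + y + z) ^+ 2)).
    by rewrite ler_sqr ?nnegrE ?(le_trans _ low).
  (* These squares give (x + y + z)^2 <= 3 (x^2 + y^2 + z^2). *)
  have := sqr_ge0 (x - y); have := sqr_ge0 (y - z); have := sqr_ge0 (x - z).
  by move: xP yP zP; rewrite !expr2; nia.
case: (posnP #|W|) => [->|W0]; first by rewrite muln0.
rewrite -(leq_pmul2l W0); move: h; rewrite /P -!natrM ler_nat.
move: (5 ^ d)%N #|M| #|W| => p m k; rewrite -!mulnn; lia.
Qed.

End SparseSet.

Lemma sparse_set_exists (n : nat) : (0 < n)%N -> exists Z : {set 'I_n},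
  (5 * #|Z| <= 2 * n)%N /\
  forall (M W : {set 'I_n}) (s : nat),
    (forall w, w \in W -> 9 * #|M| + s <= 5 * #|thirds_off Z M w|)%N ->
    (s ^ 2 * #|W| <= 81 * #|M| * (85 * n))%N.
Proof.
(* The least power of 5 above 16 n + 1 is at most 5 (16 n + 1) <= 85 n. *)
move=> n0; pose d := (trunc_log 5 (16 * n + 1)).+1.
have d0 : (0 < d)%N by [].
have nd : (16 * n + 1 < 5 ^ d)%N by apply: trunc_log_ltn.
have dn : (5 ^ d <= 85 * n)%N.
  have : (5 ^ trunc_log 5 (16 * n + 1) <= 16 * n + 1)%N by apply: trunc_logP; lia.
  by rewrite /d expnS; lia.
have [F charF cardF] := pPrimePowerField (isT : prime 5) d0.
have [t] := finField_prim_root F; rewrite cardF => t_prim.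
have tn0 m : t ^+ m != 0 by rewrite expf_neq0 // (t_neq0 t_prim nd).
pose Sb (b : F) := \sum_(z < n) gval (tr d (b * t ^+ z.*2)).
have tot : \sum_b Sb b = 0.
  rewrite exchange_big big1 // => z _.
  rewrite -[RHS](gval_mean charF d0 cardF (tn0 z.*2)).
  by apply: eq_bigr => b _; rewrite mulrC.
(* The sums [Sb b] add up to 0, and b = 0 contributes 2 n. If all 5^d - 1 others were at most -1,
   the total would be negative. [Sb b >= 0] means that the set has density at most 2/5. *)
have [b b0 Sb0] : exists2 b, b != 0 & 0 <= Sb b.
  suff /existsP[b /andP[b0 ?]] : [exists b, (b != 0) && (0 <= Sb b)] by exists b.
  apply: contraT; rewrite negb_exists => /forallP h.
  have le b : b != 0 -> Sb b <= -1.
    by move=> b0; have := h b; rewrite b0 /= -ltNge; lia.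
  have S0 : Sb 0 = 2 * n%:R.
    rewrite /Sb; under eq_bigr => z _ do rewrite mul0r.
    have -> : gval (tr d (0 : F)) = 2.
      rewrite /tr big1 => [|i _]; last by rewrite expr0n expn_eq0.
      by rewrite /gval !(eq_sym 0) -!(dvdn_pcharf charF).
    by rewrite sumr_const card_ord mulr_natr.
  have := tot; rewrite (bigD1 0) //= S0.
  have : \sum_(b | b != 0) Sb b <= \sum_(b : F | b != 0) -1 by apply: ler_sum.
  rewrite sumr_const cardC1 cardF => h1 h2.
  have h3 : (-1 : int) *+ (5 ^ d).-1 = - ((5 ^ d).-1)%:R by rewrite mulNrn.
  move: h1 h2; rewrite h3; move: (\sum_(b | _) _) => S h1 h2.
  by move: nd h1 h2; clear; lia.
exists (dead_set d n t b); split.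
  have e : Sb b = 2 * n%:R - 5 * #|dead_set d n t b|%:R.
    rewrite -sum1_card natr_sum big_mkcond mulr_sumr /=.
    have -> : 2 * n%:R = \sum_(z < n) (2 : int).
      by rewrite sumr_const card_ord mulr_natr.
    rewrite -sumrB.
    apply: eq_bigr => z _; rewrite gval_alive inE.
    by case: (alive _ _).
  by move: Sb0; rewrite e; lia.
move=> M W s hW; apply: leq_trans (sparse_bound charF d0 cardF t_prim b0 nd hW) _.
by rewrite leq_mul2l dn orbT.
Qed.

End PseudorandomSet.

(** * Breaker's win *)

Lemma exists_subset_card (T : finType) (S A : {set T}) m :
  S \subset A -> #|S| <= m <= #|A| ->
  exists S' : {set T}, [/\ S \subset S', S' \subset A & #|S'| = m].
Proof.
move=> sSA /andP[]; elim: m => [|m IH] lS lA.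
  by exists S; split=> //; apply/eqP; rewrite -leqn0.
case: (ltngtP #|S| m.+1) lS => // [lS _|e _]; last by exists S; split.
have [||S' [sS sA cS']] := IH; [by []|exact: ltnW|].
have /subsetPn[x xA xS] : ~~ (A \subset S').
  by apply/negP=> /subset_leq_card; rewrite cS' leqNgt lA.
exists (x |: S'); split; last by rewrite cardsU1 xS cS'.
  exact: subset_trans sS (subsetUr _ _).
by rewrite subUset sub1set xA.
Qed.

(* S takes as much as possible of P1, then of P2, then of P3. *)
Definition fills (T : finType) q (P1 P2 P3 A S : {set T}) : bool :=
  [&& S \subset A, #|S| == minn q #|A|, (P1 \subset S) || (S \subset P1),
      (P2 \subset S) || (S \subset P2) & (P3 \subset S) || (S \subset P3)].

(** Greedy choice: nested sets of sizes min (q, |P|) are extended along the chain P1, P2, P3, A. *)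
Lemma fills_exists (T : finType) q (P1 P2 P3 A : {set T}) :
  P1 \subset P2 -> P2 \subset P3 -> P3 \subset A ->
  exists S, fills q P1 P2 P3 A S.
Proof.
move=> s12 s23 s3A.
have step (P A' S : {set T}) : P \subset A' -> S \subset P -> #|S| = minn q #|P| ->
    exists S' : {set T}, [/\ S \subset S', S' \subset A' & #|S'| = minn q #|A'|].
  move=> sPA sSP cS; apply: exists_subset_card (subset_trans sSP sPA) _.
  by rewrite cS; have := subset_leq_card sPA; lia.
have c0 : #|finset.set0 : {set T}| = minn q #|finset.set0 : {set T}|.
  by rewrite cards0 minn0.
have [S1 [_ sS1 cS1]] := step _ _ _ (sub0set P1) (sub0set _) c0.
have [S2 [s12' sS2 cS2]] := step _ _ _ s12 sS1 cS1.
have [S3 [s23' sS3 cS3]] := step _ _ _ s23 sS2 cS2.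
have [S [s3' sS cS]] := step _ _ _ s3A sS3 cS3.
have cmp (P S' : {set T}) : S' \subset P -> #|S'| = minn q #|P| -> S' \subset S ->
    (P \subset S) || (S \subset P).
  move=> sS'P cS' sS'S; case: (leqP #|P| q) => [Pq|qP].
    suff <- : S' = P by rewrite sS'S.
    by apply/eqP; rewrite eqEcard sS'P cS' leq_min Pq leqnn.
  suff <- : S' = S by rewrite sS'P orbT.
  by apply/eqP; rewrite eqEcard sS'S cS' cS (minn_idPl (ltnW qP)) geq_minl.
exists S; apply/and5P; split=> //; first by rewrite cS.
- by apply: cmp sS1 cS1 _; apply: subset_trans s12' (subset_trans s23' s3').
- by apply: cmp sS2 cS2 _; apply: subset_trans s23' s3'.
- by apply: cmp sS3 cS3 s3'.
Qed.

(** * Breaker's strategy and its invariant *)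

Section BreakerStrategy.

Variables (n q l C : nat) (Z : {set 'I_n}).
Implicit Types (h : history n) (x y z w : 'I_n) (M S : {set 'I_n}).

(** The exceptional points, with more than 9/5 |M| + q / 250 third points off [Z]; this matches
    [sparse_set_exists] with s = q / 50. *)
Definition bad M : {set 'I_n} :=
  [set w | 450 * #|M| + q < 250 * #|thirds_off Z M w|].

Definition blocks h x : {set 'I_n} :=
  [set z in unclaimed h :\ x | [exists y in maker_set h, ap3 x y z]].

(* The game is cut into periods of l rounds: the points that are exceptional
   for Maker's set at the beginning of period k are claimed during period k. *)
Definition checkpoint k h : {set 'I_n} := bad (maker_set (take (k * l) h)).

Definition prio2 h x : {set 'I_n} :=
  blocks h x :|: checkpoint (size h %/ l) h :&: (unclaimed h :\ x).

Definition prio3 h x : {set 'I_n} := prio2 h x :|: Z :&: (unclaimed h :\ x).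

(** [fills_exists] guarantees a choice; the default only makes the function total. *)
Definition reply : breaker_strategy n := fun h x =>
  odflt finset.set0
    [pick S | fills q (blocks h x) (prio2 h x) (prio3 h x) (unclaimed h :\ x) S].

Lemma replyP h x :
  fills q (blocks h x) (prio2 h x) (prio3 h x) (unclaimed h :\ x) (reply h x).
Proof.
rewrite /reply; case: pickP => // none.
have [|||S] := @fills_exists _ q (blocks h x) (prio2 h x) (prio3 h x)
  (unclaimed h :\ x); last by rewrite none.
- exact: subsetUl.
- exact: subsetUl.
rewrite /prio3 /prio2 !subUset !subsetIr !andbT.
by apply/subsetP=> z; rewrite inE => /andP[].
Qed.

Lemma reply_legal : legal_strategy q reply.
Proof.
by move=> h x _ _; have /and5P[sS /eqP cS _ _ _] := replyP h x; split.
Qed.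

(** At q / 20 spare moves per round, C q exceptional points are claimed in 20 C rounds. A period of
    l >= 200 C rounds leaves a factor 10, and 1000 l <= q makes the terms in l small against q. *)
Hypotheses (nq : 2 * n <= q ^ 2) (Zn : 5 * #|Z| <= 2 * n)
  (bad_card : forall M, #|M| <= q -> #|bad M| <= C * q)
  (C_gt0 : 0 < C) (lC : 200 * C <= l) (ql : 1000 * l <= q).

Lemma thirds_off_sub M M' w : M' \subset M ->
  #|thirds_off Z M w| <= #|thirds_off Z M' w| + 3 * #|M :\: M'|.
Proof.
move=> sM; rewrite (mulnC 3).
apply: leq_trans (leq_add (leqnn _) (leq_card_bigcup (F := fun y =>
  [set z : 'I_n | ap3 w y z]) (k := 3) _)); last first.
  by move=> y _; apply: card_third.
apply: leq_trans (leq_card_setU _ _); apply/subset_leq_card/subsetP=> z.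
rewrite !inE => /andP[zZ /exists_inP[y yM h]].
case: (boolP (y \in M')) => yM'.
  by rewrite zZ /=; apply/orP; left; apply/exists_inP; exists y.
by apply/orP; right; apply/bigcupP; exists y; rewrite !inE ?yM'.
Qed.

Lemma play_take k h : play_against reply h -> play_against reply (take k h).
Proof.
elim=> [|h' x ph IH xU] /=; first exact: play_start.
case: (leqP k (size h')) => kh; first by rewrite -cats1 takel_cat.
by rewrite take_oversize ?size_rcons //; apply: play_round.
Qed.

Lemma maker_set_take k h : maker_set (take k h) \subset maker_set h.
Proof.
rewrite -[in X in _ \subset X](cat_take_drop k h) /maker_set big_cat.
exact: subsetUl.
Qed.

(** A round uses q + 1 points, so m (q + 1) < n <= q^2 / 2. *)
Lemma play_short h x : play_against reply h -> x \in unclaimed h ->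
  2 * size h < q.
Proof.
move=> ph xU; have : 0 < #|unclaimed h| by apply/card_gt0P; exists x.
rewrite (card_unclaimed reply_legal ph) subn_gt0 => lt.
by move: nq lt; rewrite -mulnn; clear; nia.
Qed.

(** While [Z] lasts, [inv_sparse] accounts for Breaker's m q points, m = [size h]: they lie in [Z],
    among third points off [Z], or in checkpoints of finished periods and of the current one. By
    [inv_bad], each round of the current period claims q / 20 points of its checkpoint on
    average. *)
Record inv h : Prop := Inv {
  inv_blocked : forall y y' z, y \in maker_set h -> y' \in maker_set h ->
    z \in unclaimed h -> ~~ ap3 y y' z;
  inv_free : forall y y' z, y \in maker_set h -> y' \in maker_set h ->
    z \in maker_set h -> ~~ ap3 y y' z;
  inv_good : forall k w, k.+1 * l <= size h -> w \in unclaimed h ->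
    w \notin checkpoint k h;
  inv_sparse : [disjoint Z & unclaimed h] \/
    250 * (size h * q) <= 250 * #|Z :\: unclaimed h| +
      225 * (size h * size h) + size h * (q + 1500 * l) +
      250 * (size h %/ l * (C * q)) +
      250 * #|checkpoint (size h %/ l) h :\: unclaimed h|;
  inv_bad : [disjoint checkpoint (size h %/ l) h & unclaimed h] \/
    size h %% l * q <= 20 * #|checkpoint (size h %/ l) h :\: unclaimed h| }.

Lemma l_gt0 : 0 < l. Proof. by move: C_gt0 lC; clear; lia. Qed.

Lemma card_checkpoint k h x : play_against reply h -> x \in unclaimed h ->
  #|checkpoint k h| <= C * q.
Proof.
move=> ph xU; apply: bad_card; have := play_short ph xU.
rewrite -(card_maker_set ph).
by have := subset_leq_card (maker_set_take (k * l) h); lia.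
Qed.

(** At the last checkpoint that is already cleared, w was not exceptional. Maker has gained fewer
    than 2 l points since then, each with at most 3 third points: hence 250 * 6 l = 1500 l. *)
Lemma inv_thirds h w : play_against reply h -> inv h -> w \in unclaimed h ->
  250 * #|thirds_off Z (maker_set h) w| <= 450 * size h + q + 1500 * l.
Proof.
move=> ph ih wU; have l0 := l_gt0.
have cM := card_maker_set ph.
have := divn_eq (size h) l; have := ltn_pmod (size h) l0.
case: (size h %/ l) (erefl (size h %/ l)) => [|k] ek ml em.
  have := thirds_off_sub w (sub0set (maker_set h)).
  rewrite setD0 cM.
  have -> : thirds_off Z finset.set0 w = finset.set0.
    apply/setP=> z; rewrite !inE; apply/negP=> /andP[_ /exists_inP[y]].
    by rewrite inE.
  by rewrite cards0; lia.
have kl : k.+1 * l <= size h by rewrite em leq_addr.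
have kl' : k * l <= size h by apply: leq_trans kl; rewrite leq_mul2r leqnSn orbT.
have := inv_good ih kl wU; rewrite inE -leqNgt.
have cMk := card_maker_set (play_take (k * l) ph).
rewrite size_takel // in cMk.
have := thirds_off_sub w (maker_set_take (k * l) h).
rewrite cardsD (setIidPr (maker_set_take _ _)) cM cMk.
move: em ml; rewrite mulSn.
move: (k * l) #|thirds_off _ _ w| #|thirds_off _ _ w|.
by clear; lia.
Qed.

Lemma inv_sparse_gone h x : play_against reply h -> inv h -> x \in unclaimed h ->
  3 * q <= 10 * size h -> [disjoint Z & unclaimed h].
Proof.
move=> ph ih xU qm; case: (inv_sparse ih) => // le.
have mq := play_short ph xU.
have h1 : #|Z :\: unclaimed h| <= #|Z| by rewrite subset_leq_card // subsetDl.
have h2 : #|checkpoint (size h %/ l) h :\: unclaimed h| <= C * q.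
  apply: leq_trans (card_checkpoint (size h %/ l) ph xU).
  exact/subset_leq_card/subsetDl.
have h3 : 200 * (size h %/ l * C) <= size h.
  apply: leq_trans (leq_divM (size h) l); rewrite mulnCA.
  by rewrite leq_mul2l lC orbT.
have h4 : 250 * #|Z| <= 50 * (q * q) by move: Zn nq; rewrite -mulnn; lia.
have h5 : 200 * (size h %/ l * (C * q)) <= size h * q.
  by rewrite (mulnA _ C) (mulnA 200) leq_mul2r h3 orbT.
exfalso; move: le h1 h2 h4 h5 qm mq C_gt0 lC ql.
move: (size h) (size h %/ l * _) #|Z| #|checkpoint _ _ :\: _| #|Z :\: _| => m e c b a.
clear=> le h1 h2 h4 h5 qm mq C0 lC ql.
have h6 : 1500 * l * m <= 2 * q * m by rewrite leq_mul2r; lia.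
have h7 : 200 * (C * q) <= l * q by rewrite mulnA leq_mul2r lC orbT.
have h8 : 1000 * (l * q) <= q * q by rewrite mulnA leq_mul2r ql orbT.
have h9 : 250 * (m * q) <= 51 * (q * q) + 225 * (m * m) + 5 * (m * q) by lia.
(* As 3 q^2 + 20 m^2 - 16 m q = (10 m - 3 q) (2 m - q), the range 3 q / 10 <= m < q / 2 leaves only
   m = 3 q / 10, which [h9] excludes. *)
have h10 : 16 * (m * q) <= 3 * (q * q) + 20 * (m * m) by nia.
nia.
Qed.

(** Before m = 3 q / 10 the trivial bound 3 m suffices; from then on [Z] is gone and about 9 m / 5
    with m < q / 2 applies. A twentieth of q is left for spare moves. *)
Lemma card_blocks h x : play_against reply h -> inv h -> x \in unclaimed h ->
  20 * #|blocks h x| <= 19 * q.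
Proof.
move=> ph ih xU; have mq := play_short ph xU.
case: (leqP (3 * q) (10 * size h)) => qm.
  have dZ := inv_sparse_gone ph ih xU qm.
  have sub : blocks h x \subset thirds_off Z (maker_set h) x.
    apply/subsetP=> z; rewrite !inE => /andP[/andP[_ zU] ->]; rewrite andbT.
    by apply/negP=> zZ; have := disjointFr dZ zZ; rewrite !inE zU.
  have := inv_thirds ph ih xU; have := subset_leq_card sub; lia.
have sub : blocks h x \subset
    \bigcup_(y in maker_set h) [set z : 'I_n | ap3 x y z].
  apply/subsetP=> z; rewrite inE => /andP[_ /exists_inP[y yM h3]].
  by apply/bigcupP; exists y; rewrite ?inE.
have le : #|blocks h x| <= size h * 3.
  apply: leq_trans (subset_leq_card sub) _; rewrite -(card_maker_set ph).
  by apply: leq_card_bigcup => y _; apply: card_third.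
by move: le qm; clear; lia.
Qed.

(** A reply inside the blocks has fewer than q points, so it takes the whole rest of the board. *)
Lemma reply_blocks h x : play_against reply h -> inv h -> x \in unclaimed h ->
  blocks h x \subset reply h x.
Proof.
move=> ph ih xU; have /and5P[sS /eqP cS /orP[//|sub] _ _] := replyP h x.
have le := card_blocks ph ih xU; have q0 : 0 < q.
  by move: l_gt0 ql; clear; lia.
have := subset_leq_card sub; rewrite cS => le2.
have sT : blocks h x \subset unclaimed h :\ x.
  by apply/subsetP=> z; rewrite inE => /andP[].
suff -> : reply h x = unclaimed h :\ x by [].
by apply/eqP; rewrite eqEcard sS cS; move: le le2 q0; clear; lia.
Qed.

Lemma reply_within h x (P : {set 'I_n}) :
  P = prio2 h x \/ P = prio3 h x ->
  P :&: unclaimed (rcons h (x, reply h x)) != finset.set0 ->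
  reply h x \subset P /\ #|reply h x| = q.
Proof.
have /and5P[sS /eqP cS _ c2 c3] := replyP h x.
move=> eP /set0Pn[v]; rewrite unclaimed_rcons inE in_setD => /and3P[vP vS vU].
have sub : reply h x \subset P.
  have : (P \subset reply h x) || (reply h x \subset P) by case: eP => ->.
  by case/orP=> // /subsetP/(_ v vP); rewrite (negbTE vS).
split=> //; rewrite cS; apply/minn_idPl; rewrite leqNgt; apply/negP=> lt.
have eS : reply h x = unclaimed h :\ x.
  by apply/eqP; rewrite eqEcard sS cS leq_min leqnn (ltnW lt).
by rewrite eS vU in vS.
Qed.

Lemma card_claimed_grow (A : {set 'I_n}) h x :
  #|A :\: unclaimed h| + #|A :&: reply h x| <=
  #|A :\: unclaimed (rcons h (x, reply h x))|.
Proof.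
have /and5P[sS _ _ _ _] := replyP h x.
rewrite -cardsUI.
have -> : (A :\: unclaimed h) :&: (A :&: reply h x) = finset.set0.
  apply/setP=> v; rewrite in_setI in_setD in_setI in_set0.
  apply/negP=> /andP[/andP[vU _] /andP[_ /(subsetP sS)]].
  by rewrite in_setD1 (negbTE vU) andbF.
rewrite cards0 addn0; apply/subset_leq_card/subsetP=> v.
rewrite unclaimed_rcons in_setU in_setD in_setI in_setD in_setD in_setD1.
by case: (v \in A); case: (v \in reply h x); case: (v \in unclaimed h);
  rewrite ?andbF ?andbT ?orbF.
Qed.

Lemma checkpoint_rcons k h r : k * l <= size h ->
  checkpoint k (rcons h r) = checkpoint k h.
Proof. by move=> kl; rewrite /checkpoint -cats1 takel_cat. Qed.

(** If a point of the checkpoint survives, the whole reply lies in [prio2]; at most 19 q / 20 of it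
    are blocks, and the rest falls into the checkpoint. *)
Lemma round_bad h x : play_against reply h -> inv h -> x \in unclaimed h ->
  let U' := unclaimed (rcons h (x, reply h x)) in
  let B := checkpoint (size h %/ l) h in
  [disjoint B & U'] \/ (size h %% l).+1 * q <= 20 * #|B :\: U'|.
Proof.
move=> ph ih xU U' B; case: (boolP [disjoint B & U']) => [|nd]; first by left.
right; have sU : U' \subset unclaimed h :\ x.
  by rewrite /U' unclaimed_rcons subsetDl.
have BU : B :&: U' != finset.set0 by rewrite setI_eq0.
have sP : B :&: U' \subset prio2 h x :&: U'.
  rewrite subsetI subsetIr andbT; apply: subset_trans (subsetUr _ _).
  by apply: setIS.
have P0 : prio2 h x :&: U' != finset.set0.
  by apply: contraNneq BU => e; move: sP; rewrite e subset0.
have [sub cS] := reply_within (or_introl erefl) P0.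
have IH : size h %% l * q <= 20 * #|B :\: unclaimed h|.
  case: (inv_bad ih) => // dj; case/negP: nd.
  by apply: disjointWr dj; apply: subset_trans sU (subsetDl _ _).
have := card_claimed_grow B h x; have := card_blocks ph ih xU.
have : q <= #|blocks h x| + #|B :&: reply h x|.
  rewrite -{1}cS; apply: leq_trans (leq_card_setU _ _).
  apply/subset_leq_card/subsetP=> v vS; have := subsetP sub v vS.
  rewrite /prio2 !in_setU !in_setI vS andbT.
  by case/orP=> [->//|/andP[-> _]]; rewrite orbT.
rewrite -/U' (mulSn (size h %% l)); move: IH.
move: (size h %% l * q) #|blocks h x| #|B :\: _| #|B :\: _| #|_ :&: _|.
by clear; lia.
Qed.

(** If a point of [Z] survives, the whole reply lies in [prio3], so its q points are third points
    off [Z], checkpoint points or points of [Z]. Summing 9 m / 5 over the rounds produces 225 m^2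
    after scaling by 250. *)
Lemma round_sparse h x : play_against reply h -> inv h -> x \in unclaimed h ->
  let U' := unclaimed (rcons h (x, reply h x)) in
  let B := checkpoint (size h %/ l) h in
  [disjoint Z & U'] \/
  250 * ((size h).+1 * q) <= 250 * #|Z :\: U'| +
      225 * ((size h).+1 * (size h).+1) + (size h).+1 * (q + 1500 * l) +
      250 * (size h %/ l * (C * q)) + 250 * #|B :\: U'|.
Proof.
move=> ph ih xU U' B; case: (boolP [disjoint Z & U']) => [|nd]; first by left.
right; have sU : U' \subset unclaimed h :\ x.
  by rewrite /U' unclaimed_rcons subsetDl.
have ZU : Z :&: U' != finset.set0 by rewrite setI_eq0.
have sP : Z :&: U' \subset prio3 h x :&: U'.
  rewrite subsetI subsetIr andbT; apply: subset_trans (subsetUr _ _).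
  by apply: setIS.
have P0 : prio3 h x :&: U' != finset.set0.
  by apply: contraNneq ZU => e; move: sP; rewrite e subset0.
have [sub cS] := reply_within (or_intror erefl) P0.
have IH : 250 * (size h * q) <= 250 * #|Z :\: unclaimed h| +
      225 * (size h * size h) + size h * (q + 1500 * l) +
      250 * (size h %/ l * (C * q)) + 250 * #|B :\: unclaimed h|.
  case: (inv_sparse ih) => // dj; case/negP: nd.
  by apply: disjointWr dj; apply: subset_trans sU (subsetDl _ _).
have := card_claimed_grow B h x; have := card_claimed_grow Z h x.
have := inv_thirds ph ih xU.
have : q <= #|thirds_off Z (maker_set h) x| + #|B :&: reply h x| +
    #|Z :&: reply h x|.
  rewrite -{1}cS -addnA.
  apply: leq_trans (leq_add (leqnn _) (leq_card_setU _ _)).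
  apply: leq_trans (leq_card_setU _ _).
  apply/subset_leq_card/subsetP=> v vS; rewrite !in_setU !in_setI vS !andbT.
  case/setUP: (subsetP sub v vS) => [/setUP[vT|/setIP[vB _]]|/setIP[vZ _]].
  - case: (boolP (v \in Z)) => vZ; first by rewrite !orbT.
    by move: vT; rewrite !inE vZ => /andP[_ ->].
  - by rewrite vB !orbT.
  - by rewrite vZ !orbT.
rewrite -/U' !(mulSn (size h)) (mulnS (size h)); move: IH.
move: (size h * q) (size h * size h) (size h * (q + _)) (size h %/ l * _).
move: (size h) #|thirds_off _ _ _| #|B :\: U'| #|B :\: _| #|B :&: _|
  #|Z :\: U'| #|Z :\: _| #|Z :&: _|.
by clear; lia.
Qed.

Lemma inv_round h x : play_against reply h -> inv h -> x \in unclaimed h ->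
  inv (rcons h (x, reply h x)).
Proof.
move=> ph ih xU; have l0 := l_gt0.
have Tsub := reply_blocks ph ih xU.
have sU v : v \in unclaimed (rcons h (x, reply h x)) -> v \in unclaimed h.
  by rewrite unclaimed_rcons in_setD in_setD1 => /and3P[].
have noT y z : y \in maker_set h -> z \in unclaimed (rcons h (x, reply h x)) ->
    ~~ ap3 x y z.
  move=> yM zU'; apply/negP=> h3.
  move: (zU'); rewrite unclaimed_rcons in_setD => /andP[zS zU].
  by case/negP: zS; apply: (subsetP Tsub); rewrite inE zU; apply/exists_inP; exists y.
have irr y z : ~~ ap3 y y z by rewrite /ap3 eqxx.
have irr' y z : ~~ ap3 y z z by rewrite /ap3 eqxx !andbF.
have rb := round_bad ph ih xU; have rs := round_sparse ph ih xU.
have em :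
    ((size h).+1 %/ l = size h %/ l /\ (size h).+1 %% l = (size h %% l).+1) \/
    ((size h).+1 %/ l = (size h %/ l).+1 /\ (size h).+1 %% l = 0 /\
     (size h).+1 = (size h %/ l).+1 * l /\ (size h %% l).+1 = l).
  have e := divn_eq (size h) l; have lt := ltn_pmod (size h) l0.
  case: (ltngtP (size h %% l).+1 l) lt => // [lt _|eq _].
    left; have e' : (size h).+1 = size h %/ l * l + (size h %% l).+1.
      by rewrite {1}e addnS.
    split; first by rewrite e' divnMDl // (divn_small lt) addn0.
    by rewrite e' modnMDl (modn_small lt).
  right; have e' : (size h).+1 = (size h %/ l).+1 * l.
    by rewrite {1}e -addnS eq mulSn addnC.
  by split; [rewrite {1}e' mulnK|split; [rewrite {1}e' modnMl|]].
have kl : size h %/ l * l <= size h by apply: leq_divM.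
(* A checkpoint that outlives its period would have at least l q / 20 >= 10 C q points, but it has
   at most C q. *)
have bigB : [disjoint checkpoint (size h %/ l) h &
      unclaimed (rcons h (x, reply h x))] \/ (size h %% l).+1 < l.
  case: rb => [|le]; [by left|right]; rewrite ltnNge; apply/negP=> le'.
  have := card_checkpoint (size h %/ l) ph xU.
  have := subset_leq_card (subsetDl (checkpoint (size h %/ l) h)
    (unclaimed (rcons h (x, reply h x)))).
  have := leq_mul le' (leqnn q); have := leq_mul lC (leqnn q); move: le.
  rewrite -!mulnA; have : 0 < C * q.
    by rewrite muln_gt0 C_gt0; move: l_gt0 ql; clear; lia.
  move: (C * q) (l * q) (_ * q) #|_| #|_|; clear; lia.
split.
- move=> y y' z; rewrite maker_set_rcons !in_setU1.
  move=> /orP[/eqP->|yM] /orP[/eqP->|yM'] zU' //; first exact: noT.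
    by rewrite ap3C; apply: noT.
  by apply: (inv_blocked ih) => //; apply: sU.
- move=> y y' z; rewrite maker_set_rcons !in_setU1.
  move=> /orP[/eqP->|yM] /orP[/eqP->|yM'] /orP[/eqP->|zM] //.
  + by rewrite ap3CA.
  + by rewrite ap3C ap3CA; apply: (inv_blocked ih).
  + by rewrite ap3CA; apply: (inv_blocked ih).
  + exact: (inv_blocked ih).
  + exact: (inv_free ih).
- move=> k w; rewrite size_rcons => kl1 wU'.
  case: (leqP (k.+1 * l) (size h)) => klh.
    rewrite checkpoint_rcons; first by apply: (inv_good ih) => //; apply: sU.
    by apply: leq_trans klh; rewrite leq_mul2r leqnSn orbT.
  have ek : k.+1 * l = (size h).+1 by apply/eqP; rewrite eqn_leq kl1.
  case: em => [[e1 e2]|[e1 [_ [e2 e3]]]].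
    by move: e2; rewrite -ek modnMl.
  have kk : k = size h %/ l.
    by apply/eqP; rewrite -eqSS -(eqn_pmul2r l0) ek e2.
  rewrite kk checkpoint_rcons //; case: bigB => [dj|]; last by rewrite e3 ltnn.
  by rewrite (disjointFl dj wU').
- rewrite size_rcons; case: rs => [|le]; [by left|right].
  case: em => [[-> _]|[-> [_ [e2 _]]]]; first by rewrite checkpoint_rcons.
  apply: leq_trans le _.
  (* At the end of a period its checkpoint, at most C q points, moves into the term for finished
     periods. *)
  have le : #|checkpoint (size h %/ l) h :\:
      unclaimed (rcons h (x, reply h x))| <= C * q.
    apply: leq_trans (card_checkpoint (size h %/ l) ph xU).
    exact/subset_leq_card/subsetDl.
  move: le; move: (size h %/ l) => k le; rewrite [k.+1 * _]mulSn.
  move: le; set a := #|checkpoint k h :\: _|; set c := #|checkpoint k.+1 _ :\: _|.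
  move: a c (C * q) (k * _) ((size h).+1 * _) ((size h).+1 * _) #|_| => a c.
  by clear; lia.
- rewrite size_rcons; case: em => [[-> ->]|[-> [-> _]]]; last by right; rewrite mul0n.
  by rewrite checkpoint_rcons.
Qed.

Lemma inv_start : inv [::].
Proof.
split; rewrite ?maker_set_nil.
- by move=> y y' z; rewrite inE.
- by move=> y y' z; rewrite inE.
- by move=> k w; rewrite leqn0 muln_eq0 /= => /eqP l0; have := l_gt0; rewrite l0.
- by right; rewrite /= !mul0n muln0.
- by right; rewrite /= mod0n.
Qed.

Lemma inv_play h : play_against reply h -> inv h.
Proof. by elim=> [|h' x ph ih xU]; [exact: inv_start|exact: inv_round]. Qed.

Lemma reply_winning : winning_strategy q reply.
Proof.
split; first exact: reply_legal.
move=> h /inv_play ih _ /contains_3APP[x [y [z [xM yM zM]]]].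
by apply/negP; apply: (inv_free ih).
Qed.

End BreakerStrategy.

Lemma breaker_wins_large : exists q0, forall n q,
  0 < n -> q0 <= q -> 2 * n <= q ^ 2 -> breaker_wins n q.
Proof.
(* 81 * 85 comes from [sparse_set_exists], and 100 * 100 from rounding q / 50 down to at least q /
   100. The equation keeps the large unary number folded. *)
have [C CE] : exists C, C = 100 * 100 * (81 * 85) by eexists.
have C0 : 0 < C by rewrite CE; lia.
exists (1000 * (200 * C)) => n q n0 qq nq.
have q100 : 100 <= q by lia.
have [Z [Zn Zb]] := sparse_set_exists n0.
exists (reply q (200 * C) Z); apply: (reply_winning (C := C)) => //.
move=> M Mq; set W := bad q Z M.
have hW w : w \in W -> 9 * #|M| + q %/ 50 <= 5 * #|thirds_off Z M w|.
  by rewrite inE; have := leq_divM q 50; lia.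
have le := Zb M W (q %/ 50) hW.
have s1 : q <= 100 * (q %/ 50).
  by have := divn_eq q 50; have := ltn_pmod q (isT : 0 < 50); lia.
have s2 : q ^ 2 <= 100 * 100 * (q %/ 50) ^ 2 by rewrite -!mulnn; nia.
have q20 : 0 < q ^ 2 by rewrite expn_gt0; lia.
rewrite -(leq_pmul2l q20).
apply: leq_trans (leq_mul s2 (leqnn _)) _; rewrite -mulnA.
apply: leq_trans (leq_mul (leqnn _) le) _.
have h1 : #|M| * (85 * n) <= 85 * (q * q ^ 2).
  by rewrite mulnCA leq_mul2l leq_mul //; lia.
by move: h1; rewrite CE; move: #|M| (q ^ 2); clear; nia.
Qed.

(* The bounds on the threshold bias *)
From mathcomp Require Import all_classical all_reals all_analysis.

Import Order.TTheory GRing.Theory Num.Theory.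
Import numFieldNormedType.Exports.

Local Open Scope classical_set_scope.
Local Open Scope ring_scope.

Theorem theorem1 (R : realType) :
  exists (eps : nat -> R) (C : R),
    eps n @[n --> \oo] --> (0 : R) /\
    \forall n \near \oo,
      (1 + eps n) * Num.sqrt (n%:R / (3 + 3 / 2 * Num.sqrt 3))
        <= (threshold_bias n)%:R /\
      (threshold_bias n)%:R <= Num.sqrt (2 * n%:R) + C.
Proof.
have [q0 large] := breaker_wins_large.
(* [breaker_loses] gives q > sqrt (n / 5), and 5 is below the stated constant, so eps = 0 works. C =
   1 pays for rounding sqrt (2 n) up. *)
exists (fun=> 0), 1; split; first exact: cvg_cst.
(* 10^4 is the bound in [breaker_loses]; q0^2 <= n ensures q0 <= r + 1 below. *)
exists (100 * 100 + q0 * q0)%N => // n /= Nn.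
have n0 : (0 < n)%N by lia.
rewrite /threshold_bias; case: ex_minnP => q /andP[_ /asboolP wins] qmin.
split.
  have qn : (n <= 5 * q ^ 2)%N.
    apply: ltnW; rewrite ltnNge; apply/negP=> le.
    by apply: (breaker_loses _ le wins); lia.
  (* 4/3 is the value for which 3 + 3/2 * 4/3 = 5. *)
  have sqrt3 : 4 / 3 <= Num.sqrt 3 :> R.
    rewrite -(@ler_pXn2r R 2) ?nnegrE ?sqrtr_ge0 ?divr_ge0 ?ler0n //.
    rewrite sqr_sqrtr ?ler0n // expr_div_n ler_pdivrMr ?exprn_gt0 ?ltr0n //.
    by rewrite -!natrX -natrM ler_nat.
  have K5 : 5 <= 3 + 3 / 2 * Num.sqrt 3 :> R by lra.
  rewrite addr0 mul1r -[leRHS]ger0_norm ?ler0n // -sqrtr_sqr ler_wsqrtr //.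
  rewrite ler_pdivrMr; last exact: lt_le_trans K5.
  apply: (@le_trans _ _ (q%:R ^+ 2 * 5)).
    by rewrite -natrX -natrM ler_nat mulnC.
  by rewrite ler_wpM2l // sqr_ge0.
pose r := Num.truncn (Num.sqrt (2 * n%:R) : R).
have /andP[r1 r2] := truncn_itv (sqrtr_ge0 (2 * n%:R : R)).
have n2 : (2 * n)%N%:R = 2 * n%:R :> R by rewrite natrM.
have r_large : (2 * n <= r.+1 ^ 2)%N.
  rewrite -(@ler_nat R) n2 natrX -[leLHS]sqr_sqrtr ?mulr_ge0 ?ler0n //.
  by rewrite ler_pXn2r ?nnegrE ?sqrtr_ge0 ?ler0n // ltW.
have q0r : (q0 <= r.+1)%N.
  by rewrite -(@leq_exp2r _ _ 2) //; apply: leq_trans r_large; rewrite -mulnn; lia.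
have qr : (q <= r.+1)%N.
  by apply: qmin; apply/andP; split=> //; apply/asboolP/large.
apply: (@le_trans _ _ r.+1%:R); first by rewrite ler_nat.
by rewrite -natr1 lerD2r.
Qed.
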